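(* Let $\mathcal{H}$ be a finite-dimensional Hilbert space, let $G_1,\ldots,G_J$ be Hermitian operators on $\mathcal{H}$, and for $\theta\in\mathbb{R}^J$ let $G(\theta)=\sum_{j=1}^J\theta_j G_j$ and $\rho(\theta)=e^{-G(\theta)}/\operatorname{Tr}[e^{-G(\theta)}]$. Then for all $i,j\in\{1,\ldots,J\}$ the Kubo--Mori information matrix of the family $(\rho(\theta))_{\theta\in\mathbb{R}^J}$ satisfies $$I^{\mathrm{KM}}_{ij}(\theta)=\tfrac12\operatorname{Tr}\big[\{G_i,\Phi_\theta(G_j)\}\rho(\theta)\big]-\operatorname{Tr}[G_i\rho(\theta)]\operatorname{Tr}[G_j\rho(\theta)],$$ where $\{A,B\}=AB+BA$.
   Context: The ''high-peak tent'' probability density on $\mathbb{R}$ is $p(t)=\frac{2}{\pi}\ln|\coth(\pi t/2)|$. The quantum channel $\Phi_\theta$ is defined on operators $X$ on $\mathcal{H}$ by $\Phi_\theta(X)=\int_{\mathbb{R}}dt\,p(t)\,e^{-iG(\theta)t}Xe^{iG(\theta)t}$. For a differentiable family $(\sigma(\theta))_{\theta\in\mathbb{R}^J}$ of positive-definite density operators with spectral decomposition $\sigma(\theta)=\sum_k\lambda_k|k\rangle\langle k|$, the Kubo--Mori information matrix is $I^{\mathrm{KM}}_{ij}(\theta)=\sum_{k,\ell}c_{\mathrm{KM}}(\lambda_k,\lambda_\ell)\langle k|\partial_i\sigma(\theta)|\ell\rangle\langle\ell|\partial_j\sigma(\theta)|k\rangle$, where $\partial_i=\partial/\partial\theta_i$,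 $c_{\mathrm{KM}}(x,x)=1/x$ and $c_{\mathrm{KM}}(x,y)=\frac{\ln x-\ln y}{x-y}$ for $x\neq y$. *)

(* Defs.v *)
From HB Require Import structures.
From mathcomp Require Import all_boot all_order all_algebra.
From mathcomp Require Import all_classical all_reals all_analysis.
From mathcomp Require Import complex sesquilinear spectral.

Set Implicit Arguments.
Unset Strict Implicit.
Unset Printing Implicit Defensive.

Import numFieldNormedType.Exports.
Import Order.TTheory GRing.Theory Num.Theory.
Local Open Scope ring_scope.
Local Open Scope complex_scope.
Local Open Scope sesquilinear_scope.

Section Defs.
Variable R : realType.
Local Notation C := R[i].

Definition expm n (A : 'M[C]_n) : 'M[C]_n :=
  \matrix_(k, l)
    (limn (fun N => complex.Re ((\sum_(m < N) ((m`!)%:R : C)^-1 *: A ^+ m) k l))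
     +i* limn (fun N => complex.Im ((\sum_(m < N) ((m`!)%:R : C)^-1 *: A ^+ m) k l))).

Definition coth (x : R) : R := (expR x + expR (- x)) / (expR x - expR (- x)).

Definition tent (t : R) : R := 2 / pi * ln `|coth (pi * t / 2)|.

Definition Gth n J (G : 'I_J -> 'M[C]_n) (th : 'rV[R]_J) : 'M[C]_n :=
  \sum_(j < J) (th 0 j)%:C *: G j.

Definition rho n J (G : 'I_J -> 'M[C]_n) (th : 'rV[R]_J) : 'M[C]_n :=
  (\tr (expm (- Gth G th)))^-1 *: expm (- Gth G th).

Definition Phi n J (G : 'I_J -> 'M[C]_n) (th : 'rV[R]_J) (X : 'M[C]_n)
  : 'M[C]_n :=
  let U (t : R) := expm (- ((0 +i* t) *: Gth G th)) *m X
                   *m expm ((0 +i* t) *: Gth G th) in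
  \matrix_(k, l)
    (Rintegral (@lebesgue_measure R) setT (fun t => tent t * complex.Re (U t k l))
     +i* Rintegral (@lebesgue_measure R) setT (fun t => tent t * complex.Im (U t k l))).

Definition dpart n J (F : 'rV[R]_J -> 'M[C]_n) (i : 'I_J) (th : 'rV[R]_J)
  : 'M[C]_n :=
  \matrix_(k, l)
    ((derive1 (fun s : R => complex.Re (F (th + s *: delta_mx 0 i) k l)) 0)
     +i* (derive1 (fun s : R => complex.Im (F (th + s *: delta_mx 0 i) k l)) 0)).

Definition cKM (x y : R) : R := if x == y then x^-1 else (ln x - ln y) / (x - y).

(* (U, lam) is a spectral decomposition of sigma: U unitary (its columns form an
   orthonormal eigenbasis |k>), sigma = sum_k lam_k |k><k| = U diag(lam) U^*. *)
Definition spectral_decomp n (sigma : 'M[C]_n) (U : 'M[C]_n) (lam : 'I_n -> R)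
  : Prop :=
  U \is unitarymx /\ sigma = U *m diag_mx (\row_k (lam k)%:C) *m U ^t*.

(* Kubo--Mori information matrix entry I^KM_ij(theta) of the family sigma,
   computed in the spectral decomposition (U, lam) of sigma(theta):
   sum_{k,l} c_KM(lam_k, lam_l) <k|d_i sigma|l> <l|d_j sigma|k>,
   where <k|A|l> = (U^* A U)_{kl}. *)
Definition KM_info n J (sigma : 'rV[R]_J -> 'M[C]_n) (th : 'rV[R]_J)
  (U : 'M[C]_n) (lam : 'I_n -> R) (i j : 'I_J) : C :=
  \sum_(k < n) \sum_(l < n)
     (cKM (lam k) (lam l))%:C
     * (U ^t* *m dpart sigma i th *m U) k l
     * (U ^t* *m dpart sigma j th *m U) l k.

End Defs.

(* Main.v *)
(* Let [h] be the eigenvalues of [G(th)] in the eigenbasis [U] of [rho(th)] and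
   [lam_k = exp (- h_k) / Z]. Expanding the exponential series of [- G(th + s e_i)] to
   first order in [s] shows that the derivative of [exp (- G)] has matrix elements
   [- f(h_k, h_l) <k|G_i|l>], [f] being the divided difference of [exp (- x)]; since
   [c_KM(lam_k, lam_l) f(h_k, h_l) / Z = 1], the Kubo--Mori sum collapses to
   [sum_kl (f(h_k, h_l) / Z) <k|G_i|l><l|G_j|k>] minus the product of the means.
   On the other side [Phi] multiplies [<k|X|l>] by the Fourier transform of the
   tent density at [h_k - h_l]. That transform is [tanh (w/2) / (w/2)], and
   [f(h_k, h_l) / Z = tanhc (h_k - h_l) (lam_k + lam_l) / 2].

   The Fourier transform follows from [tent t = sum_m 4/(pi (2m+1)) exp (-(2m+1) pi |t|)],
   which gives [sum_m 8 / ((2m+1)^2 pi^2 + w^2)]. This Mittag-Leffler series of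
   [tanh] is summed by telescoping [B_n / A_n], where
   [A_n = int_0^(pi/2) cos^n t cosh (a t)] and
   [B_n = int_0^(pi/2) cos^n t (t sinh (a t) / a)] satisfy two-step recurrences. *)

Require Import Defs.
From HB Require Import structures.
From mathcomp Require Import all_boot all_order all_algebra.
From mathcomp Require Import all_classical all_reals all_analysis.
From mathcomp Require Import complex sesquilinear spectral.
From mathcomp Require Import measurable_realfun ring lra.
Import numFieldNormedType.Exports.
Import Order.TTheory GRing.Theory Num.Theory.
Local Open Scope ring_scope.
Local Open Scope complex_scope.
Local Open Scope sesquilinear_scope.
Set Implicit Arguments.
Unset Strict Implicit.
Unset Printing Implicit Defensive.

(** * Integrals over a segment *)

(** [B_n] is twice the derivative of [A_n] in the parameter [a ^ 2]. Thus [B_n / A_n] is a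
    logarithmic derivative, and the telescoping is the differentiated form of Euler's product for
    cosh; Wallis integrals make its remainder vanish. In the Fourier integrals, cosine and sine are
    shifted by 1: every integrand is then nonnegative, and termwise integration is monotone
    convergence. The shift is subtracted once integrability is known. [expm], [dpart] and [Phi] are
    entrywise limits, derivatives and integrals of real and imaginary parts, whose values say
    nothing until convergence, differentiability or integrability is proved. The derivative of
    [expm] therefore comes from one bound on partial sums, quadratic in [s] and uniform in the
    truncation, which passes to the limit. The decomposition in the statement is an arbitrary one,
    possibly with repeated eigenvalues, and the dimension may be 0, where the partition function
    vanishes. *)

Lemma is_derive_continuous (R : realType) (f df : R -> R) :
  (forall x, is_derive x (1:R) f (df x)) -> continuous f.
Proof.
by move=> fP x; apply/differentiable_continuous/derivable1_diffP; case: (fP x).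
Qed.

(** The pointwise form of the power rule, made an instance so that [is_derive_eq] differentiates
    terms such as [cos t ^+ n] by instance search. *)
#[global] Instance is_derive_pow (R : realType) (f : R -> R) (n : nat) (x df : R) :
  is_derive x (1:R) f df ->
  is_derive x (1:R) (fun t => f t ^+ n) (n%:R * f x ^+ n.-1 * df).
Proof.
move=> fP; have := is_deriveX n fP; rewrite /GRing.scale /=.
by congr (is_derive _ _ _ _); apply/funext => t; rewrite fctE.
Qed.

Lemma derive_nondecreasing (R : realType) (f df : R -> R) (a b : R) :
  (forall x, is_derive x (1:R) f (df x)) ->
  (forall x, a <= x <= b -> 0 <= df x) -> a <= b -> f a <= f b.
Proof.
move=> fP df0 ab; have cf := is_derive_continuous fP.
have [|x xab] := @MVT_segment _ f df a b ab (fun x _ => fP x).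
  exact: continuous_subspaceT.
by move=> fE; rewrite -subr_ge0 fE mulr_ge0 ?subr_ge0 // df0 // -in_itv.
Qed.

Section SegmentIntegral.
Variables (R : realType) (b : R).
Hypothesis b_gt0 : 0 < b.
Local Notation mu := (@lebesgue_measure R).

Definition Iseg (f : R -> R) : R := \int[mu]_(x in `[0, b]) f x.

Lemma Iseg_integrable f : continuous f -> mu.-integrable `[0, b] (EFin \o f).
Proof.
move=> cf; apply: continuous_compact_integrable; first exact: segment_compact.
exact: continuous_subspaceT.
Qed.

Lemma Iseg_lin (x y : R) (f g : R -> R) : continuous f -> continuous g ->
  Iseg (fun t => x * f t + y * g t) = x * Iseg f + y * Iseg g.
Proof.
move=> cf cg; have mI : measurable `[0, b] by exact: measurable_itv.
rewrite /Iseg -!RintegralZl //; try exact: Iseg_integrable.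
rewrite RintegralD //; apply: Iseg_integrable => z.
  by apply: cvgM; [exact: cvg_cst|exact: cf].
by apply: cvgM; [exact: cvg_cst|exact: cg].
Qed.

Lemma Iseg_le (f g : R -> R) : continuous f -> continuous g ->
  (forall x, 0 <= x <= b -> f x <= g x) -> Iseg f <= Iseg g.
Proof.
move=> cf cg fg; apply: le_Rintegral => //=; try exact: Iseg_integrable.
Qed.

Lemma Iseg_derive (F f : R -> R) : (forall x, is_derive x (1:R) F (f x)) ->
  continuous f -> Iseg f = F b - F 0.
Proof.
move=> FP cf; have cF := is_derive_continuous FP.
rewrite /Iseg /Rintegral (@continuous_FTC2 _ f F 0 b) //.
- exact: continuous_subspaceT.
- split.
  + by move=> x _; case: (FP x).
  + by apply: cvg_at_right_filter; exact: cF.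
  + by apply: cvg_at_left_filter; exact: cF.
- by move=> x _; rewrite derive1E; apply: derive_val.
Qed.

End SegmentIntegral.

(** * Partial fractions of the hyperbolic tangent *)

Section TanhPartialFractions.
Variable R : realType.
Local Notation Ipih := (@Iseg R (pi / 2)).

Let pih_gt0 : 0 < pi / 2 :> R.
Proof. by rewrite divr_gt0 ?pi_gt0. Qed.

Let continuous_cosX n : continuous (fun t : R => cos t ^+ n).
Proof.
by apply: is_derive_continuous => x; apply: is_derive_pow.
Qed.

Let continuousMcosX n (f : R -> R) :
  continuous f -> continuous (fun t : R => cos t ^+ n * f t).
Proof. by move=> cf x; apply: cvgM; [exact: continuous_cosX|exact: cf]. Qed.

(** Two integrations by parts, packed into an antiderivative [H] that vanishes at both ends: at
    [pi / 2] through the cosine, at [0] through the sine and [v 0 = 0]. The weight [w] is free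
    because three recurrences use it, with [w] equal to [c], to [t * s t] and to [1]. *)
Lemma Ipih_cosX (w v g : R -> R) (k : nat) :
  (forall x, is_derive x (1:R) w (v x)) ->
  (forall x, is_derive x (1:R) v (g x)) -> continuous g -> v 0 = 0 ->
  k.+2%:R ^+ 2 * Ipih (fun t => cos t ^+ k.+2 * w t) +
    Ipih (fun t => cos t ^+ k.+2 * g t) =
  (k.+2 * k.+1)%:R * Ipih (fun t => cos t ^+ k * w t).
Proof.
move=> dw dv cg v0.
have cw := is_derive_continuous dw.
pose H t := - (k.+2%:R * (cos t ^+ k.+1 * sin t * w t)) - cos t ^+ k.+2 * v t.
pose h t := (k.+2 * k.+1)%:R * (cos t ^+ k * w t) +
  (-1) * (k.+2%:R ^+ 2 * (cos t ^+ k.+2 * w t) + 1 * (cos t ^+ k.+2 * g t)).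
have dH x : is_derive x (1:R) H (h x).
  apply: is_derive_eq; rewrite /GRing.scale /= /h.
  have -> : cos x ^+ k.+2 * w x = cos x ^+ k * (1 - sin x ^+ 2) * w x.
    by rewrite -cos2sin2 !exprS; ring.
  rewrite natrM !exprS -!natr1; ring: (sin2cos2 x).
have c1 := continuousMcosX (n := k) cw; have c2 := continuousMcosX (n := k.+2) cw.
have c3 := continuousMcosX (n := k.+2) cg.
have c4 : continuous (fun t : R => k.+2%:R ^+ 2 * (cos t ^+ k.+2 * w t) +
    1 * (cos t ^+ k.+2 * g t)).
  move=> x; apply: cvgD; apply: cvgM; try exact: cvg_cst; [exact: c2|exact: c3].
have ch : continuous h.
  move=> x; apply: cvgD; apply: cvgM; try exact: cvg_cst; [exact: c1|exact: c4].
have := Iseg_derive pih_gt0 dH ch; rewrite /h !Iseg_lin // /H.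
rewrite cos_pihalf sin0 v0 !exprS; lra.
Qed.

(** Start of the odd recurrences. Here the boundary term at [pi / 2] survives; it is the source of
    the numerator and denominator of the hyperbolic tangent. *)
Lemma Ipih_cos1 (w v g : R -> R) :
  (forall x, is_derive x (1:R) w (v x)) ->
  (forall x, is_derive x (1:R) v (g x)) -> continuous g -> v 0 = 0 ->
  Ipih (fun t => cos t ^+ 1 * w t) + Ipih (fun t => cos t ^+ 1 * g t) = w (pi / 2).
Proof.
move=> dw dv cg v0.
have cw := is_derive_continuous dw.
pose H t := sin t * w t + cos t ^+ 1 * v t.
pose h t := 1 * (cos t ^+ 1 * w t) + 1 * (cos t ^+ 1 * g t).
have dH x : is_derive x (1:R) H (h x).
  by apply: is_derive_eq; rewrite /GRing.scale /= /h; ring.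
have c1 := continuousMcosX (n := 1) cw; have c2 := continuousMcosX (n := 1) cg.
have ch : continuous h.
  move=> x; apply: cvgD; apply: cvgM; try exact: cvg_cst; [exact: c1|exact: c2].
have := Iseg_derive pih_gt0 dH ch; rewrite /h !Iseg_lin // /H.
rewrite cos_pihalf sin_pihalf sin0 v0 !expr1; lra.
Qed.

(* [c] and [s] are [cosh (a t)] and [sinh (a t) / a] with [k = a ^ 2]; keeping
   them abstract includes the degenerate case [a = 0], [c = 1], [s t = t]. *)
Variables (s c : R -> R) (k : R).
Hypothesis ds : forall x, is_derive x (1:R) s (c x).
Hypothesis dc : forall x, is_derive x (1:R) c (k * s x).
Hypothesis s0 : s 0 = 0.
Hypothesis c_ge1 : forall x, 1 <= c x.
Hypothesis k_ge0 : 0 <= k.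

Let cs : continuous s := is_derive_continuous ds.
Let cc : continuous c := is_derive_continuous dc.

Let A n := Ipih (fun t => cos t ^+ n * c t).
Let B n := Ipih (fun t => cos t ^+ n * (t * s t)).
(** Wallis integrals: a lower bound for [A], since [c >= 1], and the yardstick for the decay of
    [B]. *)
Let W n := Ipih (fun t => cos t ^+ n * 1).

Let cts : continuous (fun t : R => t * s t).
Proof. by move=> x; apply: cvgM; [exact: cvg_id|exact: cs]. Qed.

Let dts x : is_derive x (1:R) (fun t : R => t * s t) (s x + x * c x).
Proof. by apply: is_derive_eq; rewrite /GRing.scale /=; ring. Qed.

Let ddts x : is_derive x (1:R) (fun t : R => s t + t * c t) (2 * c x + k * (x * s x)).
Proof. by apply: is_derive_eq; rewrite /GRing.scale /=; ring. Qed.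

Let cddts : continuous (fun t : R => 2 * c t + k * (t * s t)).
Proof.
by move=> x; apply: cvgD; (apply: cvgM; first exact: cvg_cst); [exact: cc|exact: cts].
Qed.

Let Isplit n : Ipih (fun t => cos t ^+ n * (2 * c t + k * (t * s t))) =
  2 * A n + k * B n.
Proof.
rewrite -Iseg_lin //; [|exact: continuousMcosX|exact: continuousMcosX].
by congr Iseg; apply/funext => t; ring.
Qed.

Let IsplitA n : Ipih (fun t => cos t ^+ n * (k * c t)) = k * A n.
Proof.
rewrite -[RHS]addr0 -[0](mul0r (A n)) -Iseg_lin //; try exact: continuousMcosX.
by congr Iseg; apply/funext => t; ring.
Qed.

Let dks x : is_derive x (1:R) (fun t : R => k * s t) (k * c x).
Proof. by apply: is_derive_eq; rewrite /GRing.scale /=; ring. Qed.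

Let ckc : continuous (fun t : R => k * c t).
Proof. by move=> x; apply: cvgM; [exact: cvg_cst|exact: cc]. Qed.

Let A_rec n : (n.+2%:R ^+ 2 + k) * A n.+2 = (n.+2 * n.+1)%:R * A n.
Proof.
rewrite -(Ipih_cosX n dc dks ckc); last by rewrite s0 mulr0.
by rewrite IsplitA mulrDl.
Qed.

(** The second derivative of [t * s t] is [2 * c t + k * (t * s t)], so [B] obeys the recurrence of
    [A] with the extra term [2 * A n.+2]. Divided by the recurrence of [A], that term becomes one
    summand of the series. *)
Let B_rec n : 2 * A n.+2 + (n.+2%:R ^+ 2 + k) * B n.+2 = (n.+2 * n.+1)%:R * B n.
Proof.
rewrite -(Ipih_cosX n dts ddts cddts); last by rewrite s0 mul0r addr0.
by rewrite Isplit -/(B n.+2); ring.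
Qed.

Let A1 : (1 + k) * A 1 = c (pi / 2).
Proof.
rewrite -(Ipih_cos1 dc dks ckc); last by rewrite s0 mulr0.
by rewrite IsplitA mulrDl mul1r.
Qed.

Let B1 : 2 * A 1 + (1 + k) * B 1 = pi / 2 * s (pi / 2).
Proof.
rewrite -(Ipih_cos1 dts ddts cddts); last by rewrite s0 mul0r addr0.
by rewrite Isplit -/(B 1); ring.
Qed.

Let W_rec n : n.+2%:R * W n.+2 = n.+1%:R * W n.
Proof.
have d1 x : is_derive x (1:R) (fun=> 1 : R) (0:R) by exact: is_derive_cst.
have c0 : continuous (fun _ : R => 0 : R) by move=> x; exact: cvg_cst.
have d0 x : is_derive x (1:R) (fun=> 0 : R) (0:R) by exact: is_derive_cst.
have := @Ipih_cosX (fun=> 1) (fun=> 0) (fun=> 0) n d1 d0 c0 erefl.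
have -> : Ipih (fun t => cos t ^+ n.+2 * 0) = 0.
  have -> : (fun t : R => cos t ^+ n.+2 * 0) = (fun t => 0 * t + 0 * t).
    by apply/funext => t; rewrite !mul0r mulr0 addr0.
  by rewrite Iseg_lin ?mul0r ?addr0 //; move=> x; exact: cvg_id.
rewrite addr0 natrM expr2 -!mulrA => /mulfI; apply.
by rewrite pnatr_eq0.
Qed.
Let s_ge0 (x : R) : 0 <= x -> 0 <= s x.
Proof.
move=> x0; rewrite -s0; apply: (derive_nondecreasing ds) => // y _.
exact: le_trans (c_ge1 y).
Qed.

Let s_le (x : R) : 0 <= x -> s x <= x * c x.
Proof.
move=> x0; have dD y : is_derive y (1:R) (fun t : R => t * c t - s t) (y * (k * s y)).
  by apply: is_derive_eq; rewrite /GRing.scale /=; ring.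
have /= := derive_nondecreasing dD _ x0; rewrite mul0r s0 subrr subr_ge0; apply.
by move=> y /andP[y0 _]; rewrite !mulr_ge0 // s_ge0.
Qed.

Let c_le (x : R) : 0 <= x <= pi / 2 -> c x <= c (pi / 2).
Proof.
move=> /andP[x0 xpi]; apply: (derive_nondecreasing dc) => // y /andP[xy _].
by rewrite mulr_ge0 // s_ge0 // (le_trans x0).
Qed.

Let cos_le_sin (x : R) : 0 <= x <= pi / 2 -> x * cos x <= sin x.
Proof.
move=> /andP[x0 xpi].
have dD y : is_derive y (1:R) (fun t : R => sin t - t * cos t) (y * sin y).
  by apply: is_derive_eq; rewrite /GRing.scale /=; ring.
have /= := derive_nondecreasing dD _ x0; rewrite mul0r sin0 subrr subr_ge0; apply.
move=> y /andP[y0 yx]; rewrite mulr_ge0 // sin_ge0_pi // y0 /=.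
by have := pi_gt0 R; lra.
Qed.

Let W_le_A n : W n <= A n.
Proof.
apply: Iseg_le => //; [apply: continuousMcosX; exact: cst_continuous|exact: continuousMcosX|].
move=> x /andP[x0 xpi]; rewrite ler_wpM2l // exprn_ge0 // cos_ge0_pihalf //.
by have := pi_gt0 R; lra.
Qed.

(** From [s t <= t * c t] and [t * cos t <= sin t], the integrand is at most
    [cos t ^+ n * sin t ^+ 2 * c (pi / 2)], whose integral is [c (pi / 2) * (W n - W n.+2)]. By
    [W_rec], the factor [n.+1] turns this difference into [W n.+2]: this is the 1/n decay of
    [B / A]. *)
Let B_le n : n.+1%:R * B n.+2 <= c (pi / 2) * W n.+2.
Proof.
have cW j : continuous (fun t : R => cos t ^+ j * 1).
  apply: continuousMcosX; exact: cst_continuous.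
have : B n.+2 <= c (pi / 2) * W n + (- c (pi / 2)) * W n.+2.
  rewrite /W -Iseg_lin //; apply: Iseg_le => //; first exact: continuousMcosX.
    move=> x; apply: cvgD; (apply: cvgM; first exact: cvg_cst); exact: cW.
  move=> x xpi; have /andP[x0 xle] := xpi.
  have cx0 : 0 <= cos x.
    by rewrite cos_ge0_pihalf //; have := pi_gt0 R; lra.
  have -> : c (pi / 2) * (cos x ^+ n * 1) + - c (pi / 2) * (cos x ^+ n.+2 * 1) =
     cos x ^+ n * (sin x ^+ 2 * c (pi / 2)) by rewrite sin2cos2 !exprS; ring.
  have -> : cos x ^+ n.+2 * (x * s x) = cos x ^+ n * (cos x * (cos x * (x * s x))).
    by rewrite !exprS; ring.
  rewrite ler_wpM2l ?exprn_ge0 //.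
  apply: (@le_trans _ _ ((x * cos x) ^+ 2 * c x)).
    have -> : (x * cos x) ^+ 2 * c x = cos x * (cos x * (x * (x * c x))) by ring.
    by rewrite !ler_wpM2l // s_le.
  apply: ler_pM; rewrite ?sqr_ge0 //; first by apply: le_trans (c_ge1 x).
    by rewrite ler_sqr ?nnegrE ?mulr_ge0 ?cos_le_sin // sin_ge0_pi // x0 /=;
       have := pi_gt0 R; lra.
  exact: c_le.
rewrite mulNr -mulrBr => /(ler_wpM2l (ler0n R n.+1)).
rewrite mulrCA mulrBr -W_rec => /le_trans; apply.
by rewrite -mulrBl -natrB // subSnn mul1r.
Qed.

Let A_gt0 N : 0 < A N.*2.+1.
Proof.
elim: N => [|N IH].
  rewrite -(pmulr_rgt0 _ (_ : 0 < 1 + k)) ?A1; first by apply: lt_le_trans (c_ge1 _).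
  by rewrite ltr_wpDr.
rewrite doubleS -(pmulr_rgt0 _ (_ : 0 < N.*2.+3%:R ^+ 2 + k)) ?A_rec ?mulr_gt0 //.
by rewrite ltr_wpDr // exprn_gt0.
Qed.

Let B_ge0 n : 0 <= B n.
Proof.
have c0 : continuous (fun t : R => cos t ^+ n * 0).
  apply: continuousMcosX; exact: cst_continuous.
have -> : 0 = Ipih (fun t : R => cos t ^+ n * 0).
  rewrite -[RHS](_ : 0 * A n + 0 * A n = _); first by rewrite !mul0r addr0.
  rewrite -Iseg_lin //; try exact: continuousMcosX.
  by congr Iseg; apply/funext => t; rewrite mulr0 !mul0r addr0.
apply: Iseg_le => //; first exact: continuousMcosX.
move=> x /andP[x0 xpi]; rewrite ler_wpM2l ?mulr_ge0 ?s_ge0 // exprn_ge0 //.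
by rewrite cos_ge0_pihalf //; have := pi_gt0 R; lra.
Qed.

Let L := pi / 2 * s (pi / 2) / c (pi / 2).

Let f (m : nat) : R := 2 / (m.*2.+1%:R ^+ 2 + k).

(** Telescoping: [B n / A n - B n.+2 / A n.+2 = 2 / (n.+2 ^ 2 + k)], the quotient of [B_rec] by
    [A_rec]. The boundary value [L] enters through [A1] and [B1]. *)
Let sum_f N : series f N.+1 = L - B N.*2.+1 / A N.*2.+1.
Proof.
elim: N => [|N IH].
  have k1 : 1 + k != 0 by rewrite gt_eqF // ltr_wpDr.
  have c1 : c (pi / 2) != 0 by rewrite gt_eqF // (lt_le_trans _ (c_ge1 _)).
  rewrite /series /= big_nat1 /f /L -B1 -A1 expr1n.
  have := A_gt0 0 => /gt_eqF /= a0; field; rewrite /A in a0 *.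
  by rewrite k1 -/(A 1) a0.
rewrite seriesSr IH /f doubleS.
have kk : N.*2.+3%:R ^+ 2 + k != 0 by rewrite gt_eqF // ltr_wpDr // exprn_gt0.
have a1 := A_gt0 N; have a3 := A_gt0 N.+1; rewrite doubleS in a3.
have aE := A_rec N.*2.+1; have bE := B_rec N.*2.+1.
set t := _ ^+ 2 + k in kk aE bE *; set u := (_ * _)%:R in aE bE.
have u0 : u != 0 by rewrite /u pnatr_eq0.
have -> : A N.*2.+1 = t * A N.*2.+3 / u by rewrite aE mulrC mulKf.
have -> : B N.*2.+1 = (2 * A N.*2.+3 + t * B N.*2.+3) / u by rewrite bE mulrC mulKf.
by field; rewrite kk gt_eqF //= !gt_eqF // ltr_wpDr.
Qed.

Lemma tanh_partial_fractions :
  (series (fun m => 2 / (m.*2.+1%:R ^+ 2 + k)) @ \oo -->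
   pi / 2 * s (pi / 2) / c (pi / 2))%classic.
Proof.
(* Shift by two: one term because [sum_f] starts at one summand, one more so that the exponent
   [2n + 3] has the form required by [B_le]. *)
rewrite -/f -/L -(cvg_shiftn 2).
apply: (@squeeze_cvgr _ _ _ _ (fun n => L - c (pi / 2) * harmonic n) (fun=> L)).
- near=> n; rewrite /= addn2 sum_f doubleS.
  have a0 := A_gt0 n.+1; rewrite doubleS in a0.
  rewrite lerD2l lerN2 lerBlDr lerDl divr_ge0 ?B_ge0 ?(ltW a0) // andbT.
  rewrite ler_pdivrMr // mulrAC ler_pdivlMr // mulrC.
  apply: le_trans (_ : _ <= n.*2.+2%:R * B n.*2.+3) _.
    by rewrite ler_wpM2r ?B_ge0 // ler_nat -addnn !ltnS leqW // leq_addr.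
  apply: le_trans (B_le _) _.
  by rewrite ler_wpM2l ?W_le_A // (le_trans _ (c_ge1 _)).
- rewrite -[X in (_ --> X)%classic]subr0; apply: cvgB; first exact: cvg_cst.
  rewrite -[X in (_ --> X)%classic](mulr0 (c (pi / 2))); apply: cvgM; first exact: cvg_cst.
  exact: cvg_harmonic.
- exact: cvg_cst.
Unshelve. all: by end_near. Qed.

End TanhPartialFractions.

(** * Exponential series of the tent density *)

(** [(expR w - 1) / (expR w + 1)] is tanh (w/2); the value at 0 is the limit. *)
Definition tanhc (R : realType) (w : R) : R :=
  if w == 0 then 1 else 2 / w * ((expR w - 1) / (expR w + 1)).

Section TanhSeries.
Variable R : realType.
Implicit Types w q t : R.

Lemma cosh_ge1 (x : R) : 1 <= (expR x + expR (- x)) / 2.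
Proof.
have x0 := expR_gt0 x; rewrite expRN ler_pdivlMr // mul1r.
have -> : expR x + (expR x)^-1 = 2 + (expR x - 1) ^+ 2 / expR x.
  by field; rewrite gt_eqF.
by rewrite lerDl divr_ge0 ?sqr_ge0 ?ltW.
Qed.

Lemma tanhc_series w :
  (series (fun m => 8 / (m.*2.+1%:R ^+ 2 * pi ^+ 2 + w ^+ 2)) @ \oo
    --> tanhc w)%classic.
Proof.
have p0 : (pi : R) != 0 by rewrite gt_eqF // pi_gt0.
have p2 : 0 < (pi : R) ^+ 2 by rewrite exprn_gt0 // pi_gt0.
(* Factoring [pi ^+ 2] out of the denominators reduces the series to [tanh_partial_fractions] with
   parameter [a ^+ 2]. *)
pose a := w / pi.
have -> : (fun m => 8 / (m.*2.+1%:R ^+ 2 * pi ^+ 2 + w ^+ 2)) =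
          (fun m => 4 / pi ^+ 2 * (2 / (m.*2.+1%:R ^+ 2 + a ^+ 2))).
  apply/funext => m; rewrite /a.
  have d0 : 0 < m.*2.+1%:R ^+ 2 :> R by rewrite exprn_gt0 // ltr0n.
  move: (m.*2.+1%:R : R) d0 (pi : R) p0 p2 => d d0 p p0 p2.
  have e0 : 0 < d ^+ 2 * p ^+ 2 + w ^+ 2 by rewrite ltr_wpDr ?sqr_ge0 // mulr_gt0.
  by field; rewrite p0 /= gt_eqF //; nra.
have sE (u : R^nat) (x l : R) : (series u @ \oo --> l)%classic ->
    (series (fun m => x * u m) @ \oo --> x * l)%classic.
  move=> ul; have -> : series (fun m => x * u m) = (fun n => x * series u n).
    by apply/funext => n; rewrite /series /= mulr_sumr.
  by apply: cvgM => //; exact: cvg_cst.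
have [w0|w0] := eqVneq w 0.
  (* Degenerate instance [c = 1], [s t = t]: it yields the sum of the inverse odd squares, pi^2 /
     8. *)
  rewrite /tanhc w0 eqxx.
  have d1 (x : R) : is_derive x (1:R) (fun t : R => t) 1 by exact: is_derive_id.
  have d2 (x : R) : is_derive x (1:R) (fun _ : R => 1 : R) (a ^+ 2 * x).
    by rewrite /a w0 mul0r expr0n mul0r; exact: is_derive_cst.
  have := sE _ (4 / pi ^+ 2) _
    (tanh_partial_fractions d1 d2 erefl (fun _ => lexx _) (sqr_ge0 a)).
  by congr (_ --> _)%classic; move: (pi : R) p0 => p p0; field.
have a0 : a != 0 by rewrite mulf_neq0 ?invr_eq0.
pose s t := (expR (a * t) - expR (- (a * t))) / (2 * a).
pose c t := (expR (a * t) + expR (- (a * t))) / 2.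
have ds x : is_derive x (1:R) s (c x).
  have -> : s = fun t => (2 * a)^-1 * (expR (a * t) - expR (- (a * t))).
    by apply/funext => t; rewrite mulrC.
  by apply: is_derive_eq; rewrite /GRing.scale /= /c; field; rewrite a0.
have dc x : is_derive x (1:R) c (a ^+ 2 * s x).
  have -> : c = fun t => 2^-1 * (expR (a * t) + expR (- (a * t))).
    by apply/funext => t; rewrite mulrC.
  by apply: is_derive_eq; rewrite /GRing.scale /= /s; field; rewrite a0.
have s0 : s 0 = 0 by rewrite /s mulr0 oppr0 subrr mul0r.
have := sE _ (4 / pi ^+ 2) _
  (tanh_partial_fractions ds dc s0 (fun x => cosh_ge1 (a * x)) (sqr_ge0 a)).
congr (_ --> _)%classic; rewrite /tanhc (negbTE w0) /s /c.
have -> : a * (pi / 2) = w / 2 by rewrite /a mulrA divfK.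
have -> : expR w = expR (w / 2) ^+ 2 by rewrite -expRM_natl; congr expR; field.
rewrite expRN; have := expR_gt0 (w / 2); set e := expR (w / 2) => e0.
rewrite /a; move: (pi : R) p0 => p p0; field; rewrite p0 w0 !gt_eqF //=.
all: by rewrite ltr_wpDl ?sqr_ge0.
Qed.

(** The remainder [r N] vanishes at 0, and summing the geometric series gives it the derivative
    [2 * y ^+ N.*2 / (1 - y ^+ 2)]. The mean value theorem on [[0, q]] then bounds it by a geometric
    sequence in [q ^+ 2]. *)
Lemma ln_series q : 0 <= q < 1 ->
  (series (fun m => 2 * (q ^+ m.*2.+1 / m.*2.+1%:R)) @ \oo
   --> ln (1 + q) - ln (1 - q))%classic.
Proof.
move=> /andP[q0 q1].
pose r N (y : R) := ln (1 + y) - ln (1 - y) -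
  series (fun m => 2 * (y ^+ m.*2.+1 / m.*2.+1%:R)) N.
have dS N (y : R) : is_derive y (1:R)
    (fun y => series (fun m => 2 * (y ^+ m.*2.+1 / m.*2.+1%:R)) N)
    (\sum_(0 <= m < N) 2 * y ^+ m.*2).
  elim: N => [|N IH].
    rewrite big_geq //; have -> : (fun y : R =>
        series (fun m => 2 * (y ^+ m.*2.+1 / m.*2.+1%:R)) 0) = cst 0.
      by apply/funext => z; rewrite /series /= big_geq.
    exact: is_derive_cst.
  have -> : (fun y : R => series (fun m => 2 * (y ^+ m.*2.+1 / m.*2.+1%:R)) N.+1) =
    (fun y => series (fun m => 2 * (y ^+ m.*2.+1 / m.*2.+1%:R)) N +
              2 / N.*2.+1%:R * y ^+ N.*2.+1).
    by apply/funext => z; rewrite seriesSr; congr (_ + _); rewrite -mulrA [_^-1 * _]mulrC.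
  rewrite big_nat_recr //=.
  apply: is_derive_eq; rewrite /GRing.scale /=.
  have : N.*2.+1%:R != 0 :> R by rewrite pnatr_eq0.
  by move: (N.*2.+1%:R : R) => d d0; congr (_ + _); field.
have geo N (y : R) : (1 - y ^+ 2) * \sum_(0 <= m < N) 2 * y ^+ m.*2 = 2 * (1 - y ^+ N.*2).
  elim: N => [|N IH]; first by rewrite big_geq // mulr0 expr0 subrr mulr0.
  by rewrite big_nat_recr //= mulrDr IH doubleS !exprS; ring.
have dr N (y : R) : 0 <= y <= q -> is_derive y (1:R) (r N) (2 * y ^+ N.*2 / (1 - y ^+ 2)).
  move=> /andP[y0 yq].
  have y1 : 0 < 1 + y by lra.
  have y2 : 0 < 1 - y by lra.
  have d1 := is_derive1_ln y1; have d2 := is_derive1_ln y2.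
  have e1 : is_derive y (1:R) (fun t : R => ln (1 + t)) ((1 + y)^-1 * 1).
    have e : is_derive y (1:R) (fun t : R => 1 + t) (1:R).
      by apply: is_derive_eq; rewrite /GRing.scale /=; ring.
    exact: (@is_derive1_comp _ (@ln R) (fun t => 1 + t) y _ _ d1 e).
  have e2 : is_derive y (1:R) (fun t : R => ln (1 - t)) ((1 - y)^-1 * (-1)).
    have e : is_derive y (1:R) (fun t : R => 1 - t) (-1:R).
      by apply: is_derive_eq; rewrite /GRing.scale /=; ring.
    exact: (@is_derive1_comp _ (@ln R) (fun t => 1 - t) y _ _ d2 e).
  have z0 : 1 - y ^+ 2 != 0 
    by rewrite (_ : _ - _ = (1 - y) * (1 + y)); [rewrite mulf_neq0 // gt_eqF|ring].
  apply: is_derive_eq.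
  have -> : \sum_(0 <= m < N) 2 * y ^+ m.*2 = 2 * (1 - y ^+ N.*2) / (1 - y ^+ 2).
    by rewrite -geo mulrC mulKf.
  by field; rewrite z0 !gt_eqF.
have rB N : `|r N q| <= 2 / (1 - q ^+ 2) * (q ^+ 2) ^+ N.
  have [x| |x xin] := @MVT_segment _ (r N) (fun y => 2 * y ^+ N.*2 / (1 - y ^+ 2)) 0 q q0.
  - by rewrite in_itv /= => /andP[x0 xq]; apply: dr; rewrite !ltW.
  - apply: derivable_within_continuous => x; rewrite in_itv /= => xq.
    by case: (dr N x xq).
  have -> : r N 0 = 0.
    rewrite /r addr0 subr0 subrr sub0r /series /= big1 ?oppr0 // => m _.
    by rewrite expr0n mul0r mulr0.
  move: xin; rewrite in_itv /= => /andP[x0 xq].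
  rewrite !subr0 => ->.
  have q2 : 0 < 1 - q ^+ 2 by rewrite subr_gt0 expr_lt1.
  have x2 : 1 - q ^+ 2 <= 1 - x ^+ 2 by rewrite lerD2l lerN2 ler_sqr ?nnegrE.
  have x3 := lt_le_trans q2 x2.
  rewrite ger0_norm; last by rewrite !mulr_ge0 ?exprn_ge0 ?invr_ge0 ?(ltW x3).
  rewrite -[leRHS]mulr1 ler_pM ?(ltW q1) //.
    by rewrite !mulr_ge0 ?exprn_ge0 ?invr_ge0 ?(ltW x3).
  rewrite mulrAC ler_pM ?mulr_ge0 ?exprn_ge0 ?invr_ge0 ?(ltW x3) //.
    by rewrite ler_wpM2l // lef_pV2 ?posrE.
  by rewrite -exprM mul2n lerXn2r ?nnegrE.
apply/cvgrPdist_le => e e0; near=> N.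
apply: le_trans (rB N) _; near: N.
have : ((fun N => 2 / (1 - q ^+ 2) * (q ^+ 2) ^+ N) @ \oo --> 2 / (1 - q ^+ 2) * 0)%classic.
  apply: cvgM; first exact: cvg_cst.
  by apply: cvg_expr; rewrite ger0_norm ?sqr_ge0 // expr_lt1.
rewrite mulr0 => /cvgrPdist_le /(_ e e0); apply: filterS => n.
by rewrite sub0r normrN; apply: le_trans; exact: ler_norm.
Unshelve. all: by end_near. Qed.

Lemma tentN t : tent (- t) = tent t.
Proof.
rewrite /tent /coth mulrN mulNr opprK addrC -[in LHS]opprB invrN mulrN normrN.
by [].
Qed.

(** A default value: the density is infinite at 0, but division by zero makes [coth 0 = 0], and
    [ln 0 = 0]. The integral does not see this point. *)
Lemma tent0 : tent (0 : R) = 0.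
Proof. by rewrite /tent /coth mulr0 mul0r oppr0 subrr invr0 mulr0 normr0 ln0 ?mulr0. Qed.

Lemma tentE t : 0 < t ->
  tent t = 2 / pi * (ln (1 + expR (- (pi * t))) - ln (1 - expR (- (pi * t)))).
Proof.
move=> t0; set q := expR _.
have p0 : 0 < (pi : R) := pi_gt0 R.
have q0 : 0 < q by exact: expR_gt0.
have q1 : q < 1 by rewrite expR_lt1 oppr_lt0 mulr_gt0.
rewrite /tent; congr (_ * _).
have -> : coth (pi * t / 2) = (1 + q) / (1 - q).
  rewrite /coth; have -> : q = expR (- (pi * t / 2)) ^+ 2.
    by rewrite /q -expRM_natl; congr expR; field.
  have -> : expR (pi * t / 2) = (expR (- (pi * t / 2)))^-1 by rewrite expRN invrK.
  have e0 := expR_gt0 (- (pi * t / 2)).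
  have e1 : expR (- (pi * t / 2)) < 1 by rewrite expR_lt1 oppr_lt0 divr_gt0 ?mulr_gt0.
  set e := expR _ in e0 e1 *.
  have : 0 < 1 - e ^+ 2 by rewrite subr_gt0 expr_lt1 // ltW.
  by move=> /gt_eqF e2; field; rewrite e2 gt_eqF.
by rewrite ger0_norm ?ln_div ?posrE ?divr_ge0 //; lra.
Qed.

Lemma tent_series t : 0 < t ->
  (series (fun m => 4 / (pi * m.*2.+1%:R) * expR (- (m.*2.+1%:R * pi * t))) @ \oo
     --> tent t)%classic.
Proof.
move=> t0.
pose q := expR (- (pi * t)).
have p0 : 0 < (pi : R) := pi_gt0 R.
have q0 : 0 < q by exact: expR_gt0.
have q1 : q < 1 by rewrite expR_lt1 oppr_lt0 mulr_gt0.
rewrite tentE // -/q.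
have := @ln_series q; rewrite (ltW q0) q1 => /(_ isT) h.
have -> : series (fun m => 4 / (pi * m.*2.+1%:R) * expR (- (m.*2.+1%:R * pi * t))) =
  (fun n => 2 / pi * series (fun m => 2 * (q ^+ m.*2.+1 / m.*2.+1%:R)) n).
  apply/funext => n; rewrite /series /= mulr_sumr; apply: eq_bigr => m _.
  have -> : expR (- (m.*2.+1%:R * pi * t)) = q ^+ m.*2.+1.
    by rewrite /q -expRM_natl mulrN mulrA.
  have : m.*2.+1%:R != 0 :> R by rewrite pnatr_eq0.
  by move: (m.*2.+1%:R : R) (pi : R) p0 => d p p0 d0; field; rewrite d0 gt_eqF.
by apply: cvgM => //; exact: cvg_cst.
Qed.

End TanhSeries.

(** * Fourier transform of the tent density *)

Section TentIntegrals.
Variable R : realType.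
Implicit Types w t a : R.
Local Notation mu := (@lebesgue_measure R).

Lemma cvg_expRNM a : 0 < a -> (expR (- (a * t)) @[t --> +oo] --> (0 : R))%classic.
Proof.
move=> a0; apply: (@cvg_comp _ _ _ (fun t => a * t) (fun u => expR (- u)) _ (pinfty_nbhs R)).
  by apply: gt0_cvgMry => //; exact: cvg_id.
exact: cvgr_expR.
Qed.

(** The antiderivative is [expR (- (a * t))] times a bounded trigonometric factor [H], hence tends
    to 0 at infinity. The condition [0 <= y <= x] keeps the integrand nonnegative, as the improper
    fundamental theorem requires; the cases used are [x = y = 2] and [x = 2], [y = 0]. *)
Lemma integral_expR_cos (a w x y : R) : 0 < a -> 0 <= y <= x ->
  (\int[mu]_(t in `[0%R, +oo[) (expR (- (a * t)) * (x + y * cos (w * t)))%:E =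
   (x / a + y * a / (a ^+ 2 + w ^+ 2))%:E)%E.
Proof.
move=> a0 /andP[y0 yx].
have aw : 0 < a ^+ 2 + w ^+ 2 by rewrite ltr_wpDr ?sqr_ge0 // exprn_gt0.
pose H t := y * (w * sin (w * t) - a * cos (w * t)) / (a ^+ 2 + w ^+ 2) - x / a.
pose F t := expR (- (a * t)) * H t.
pose f t := expR (- (a * t)) * (x + y * cos (w * t)).
have dH t : is_derive t (1:R) H
    (y * (w ^+ 2 * cos (w * t) + a * w * sin (w * t)) / (a ^+ 2 + w ^+ 2)).
  have -> : H = fun t => (y / (a ^+ 2 + w ^+ 2)) * (w * sin (w * t) - a * cos (w * t)) - x / a.
    by apply/funext => u; rewrite /H mulrAC.
  by apply: is_derive_eq; rewrite /GRing.scale /=; field; rewrite gt_eqF.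
have dF t : is_derive t (1:R) F (f t).
  by apply: is_derive_eq; rewrite /GRing.scale /= /f /H; field; rewrite !gt_eqF.
have df t : is_derive t (1:R) f (- a * expR (- (a * t)) * (x + y * cos (w * t)) -
    expR (- (a * t)) * (y * w * sin (w * t))).
  by apply: is_derive_eq; rewrite /GRing.scale /=; ring.
have cF := is_derive_continuous dF.
have cf := is_derive_continuous df.
have -> : x / a + y * a / (a ^+ 2 + w ^+ 2) = 0 - F 0.
  by rewrite /F /H !mulr0 oppr0 expR0 sin0 cos0; field; rewrite !gt_eqF.
rewrite EFinB; apply: (@ge0_continuous_FTC2y _ f F).
- move=> t _; rewrite mulr_ge0 ?expR_ge0 //.
  by have := cos_geN1 (w * t); nra.
- exact: continuous_subspaceT.
- pose M := `|y| * (`|w| + `|a|) / (a ^+ 2 + w ^+ 2) + `|x / a|.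
  have HM t : `|H t| <= M.
    apply: le_trans (ler_normB _ _) _; rewrite lerD2r normrM normfV.
    rewrite [X in _ / X]gtr0_norm // ler_pM2r ?invr_gt0 // normrM ler_wpM2l //.
    apply: le_trans (ler_normB _ _) _; rewrite !normrM; apply: lerD.
      by rewrite ler_piMr // sin_max.
    by rewrite ler_piMr // cos_max.
  have Fb t : - (expR (- (a * t)) * M) <= F t <= expR (- (a * t)) * M.
    by rewrite -ler_norml normrM (ger0_norm (expR_ge0 _)) ler_wpM2l ?expR_ge0.
  have c0 : (expR (- (a * t)) * M @[t --> +oo] --> (0 : R))%classic.
    by rewrite -(mul0r M); apply: cvgM; [exact: cvg_expRNM|exact: cvg_cst].
  apply: (@squeeze_cvgr _ _ _ _ (fun t => - (expR (- (a * t)) * M))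
    (fun t => expR (- (a * t)) * M)) => //.
    by near=> t; exact: Fb.
  by rewrite -oppr0; exact: cvgN.
- by move=> t _; case: (dF t).
- by apply: cvg_at_right_filter; exact: cF.
- by move=> t _; rewrite derive1E; apply: derive_val.
Unshelve. all: by end_near. Qed.

Lemma ge0_integralT_fold (g : R -> R) : continuous g -> (forall t, 0 <= g t) ->
  (\int[mu]_t (g t)%:E = \int[mu]_(t in `[0%R, +oo[) (g t + g (- t))%:E)%E.
Proof.
move=> cg g0.
have mg : measurable_fun [set: R] g by exact: continuous_measurable_fun.
have cgN : continuous (g \o -%R).
  by move=> t; apply: continuous_comp; [exact: opp_continuous|exact: cg].
have mgN : measurable_fun [set: R] (g \o -%R) by exact: continuous_measurable_fun.
have mp : measurable [set x : R | 0 <= x] by rewrite -set_itvcy.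
rewrite -(setUv [set x : R | 0 <= x]) ge0_integral_setU //=; last 4 first.
- exact: measurableC.
- by apply/measurable_EFinP; rewrite setUv.
- by move=> x _; rewrite lee_fin.
- exact/disj_setPCl.
rewrite -set_itvcy // setCitvr.
(* The complement of the closed half-line is open at 0; adding this null endpoint puts it in the
   form that the substitution [t -> - t] expects. *)
rewrite integral_itv_bndo_bndc; last exact/measurable_EFinP/measurable_funTS.
rewrite -{2}oppr0 ge0_integration_by_substitutionNy //; last exact: continuous_subspaceT.
under [RHS]eq_integral do rewrite EFinD.
rewrite ge0_integralD //.
- by move=> x _; rewrite lee_fin.
- exact/measurable_EFinP/measurable_funTS.
- by move=> x _; rewrite lee_fin.
- exact/measurable_EFinP/measurable_funTS.
Qed.

Lemma measurable_tent : measurable_fun [set: R] (@tent R).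
Proof.
pose q t := expR (- (pi * `|t|)).
(* The test at 0 is needed: there the logarithmic formula would give [2 / pi * ln 2] instead of the
   default value 0. *)
have -> : @tent R = fun t => if t == 0 then 0 else 2 / pi * (ln (1 + q t) - ln (1 - q t)).
  apply/funext => t; have [->|t0] := eqVneq t 0; first exact: tent0.
  rewrite /q; have [tp|tn] := ltP 0 t; first by rewrite gtr0_norm // tentE.
  have tn' : 0 < - t by rewrite oppr_gt0 lt_neqAle t0.
  by rewrite ler0_norm // -tentE // tentN.
have cq : continuous q.
  move=> t; apply: continuous_comp; last exact: continuous_expR.
  apply: continuousN; apply: cvgM; first exact: cvg_cst.
  exact: norm_continuous.
have mq : measurable_fun [set: R] q by exact: continuous_measurable_fun.
apply: measurable_fun_ifT => //.
- exact: measurable_fun_eqr.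
- apply: measurable_funM => //; apply: measurable_funB; apply: measurableT_comp => //.
    exact: measurable_funD.
  exact: measurable_funB.
Qed.

Let coef m : R := 4 / (pi * m.*2.+1%:R).
Let rate m : R := m.*2.+1%:R * pi.

Let coef_ge0 m : 0 <= coef m.
Proof. by rewrite divr_ge0 // mulr_ge0 // pi_ge0. Qed.

Let rate_gt0 m : 0 < rate m.
Proof. by rewrite mulr_gt0 ?pi_gt0. Qed.

Lemma tent_ge0 t : 0 <= tent t.
Proof.
wlog t0 : t / 0 < t => [H|].
  have [t0|t0|t0] := ltgtP 0 t; [exact: H| |by rewrite -t0 tent0].
  by rewrite -tentN; apply: H; rewrite oppr_gt0.
rewrite tentE //; have p0 : 0 < (pi : R) := pi_gt0 R.
have q0 := expR_gt0 (- (pi * t)).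
have q1 : expR (- (pi * t)) < 1 by rewrite expR_lt1 oppr_lt0 mulr_gt0.
by rewrite mulr_ge0 ?divr_ge0 ?(ltW p0) // subr_ge0 ler_ln ?posrE; lra.
Qed.

(** Expands [tent] into exponentials and integrates termwise; nonnegativity of [K] makes the
    exchange of sum and integral free of any domination argument. *)
Lemma ge0_integral_tentM (K : R -> R) (v : R^nat) (l : R) :
  continuous K -> (forall t, 0 <= K t) ->
  (forall m, (\int[mu]_t (expR (- (rate m * `|t|)) * K t)%:E = (v m)%:E)%E) ->
  (series (fun m => coef m * v m) @ \oo --> l)%classic ->
  (\int[mu]_t (tent t * K t)%:E = l%:E)%E.
Proof.
move=> cK K0 vE vl.
pose h m t := coef m * (expR (- (rate m * `|t|)) * K t).
have ch0 m : continuous (fun t => expR (- (rate m * `|t|)) * K t).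
  move=> t; apply: cvgM; last exact: cK.
  apply: continuous_comp; last exact: continuous_expR.
  apply: continuousN; apply: cvgM; first exact: cvg_cst.
  exact: norm_continuous.
have ch m : continuous (h m).
  by move=> t; apply: cvgM; [exact: cvg_cst|exact: ch0].
have h0 m t : 0 <= h m t by rewrite /h mulr_ge0 // mulr_ge0 // expR_ge0.
have mh m : measurable_fun [set: R] (EFin \o h m).
  by apply/measurable_EFinP; exact: continuous_measurable_fun.
have eserE (u : R^nat) (x : R) : (series u @ \oo --> x)%classic ->
    (\sum_(0 <= m <oo) (u m)%:E = x%:E)%E.
  move=> ux; apply/cvg_lim => //; apply: cvg_EFin.
    by apply: nearW => n; rewrite sumEFin.
  by under eq_fun do rewrite /= sumEFin.
have E1 : (\int[mu]_t (tent t * K t)%:E = \int[mu]_t \sum_(0 <= m <oo) (h m t)%:E)%E.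
  apply: ge0_ae_eq_integral => //.
  - apply/measurable_EFinP/measurable_funM; first exact: measurable_tent.
    exact: continuous_measurable_fun.
  - have := @ge0_emeasurable_sum _ _ _ setT (fun m => EFin \o h m) xpredT.
  by apply => [m t _ _|m _]; [rewrite lee_fin|exact: mh].
  - by move=> t _; rewrite lee_fin mulr_ge0 ?tent_ge0.
  - by move=> t _; apply: nneseries_ge0 => m _ _; rewrite lee_fin.
  (* The expansion holds only off 0: there the exponential series diverges while [tent] takes its
     default value. *)
  exists [set 0]%classic; split => //; first exact: lebesgue_measure_set1.
  move=> t /= H; apply/eqP/negPn/negP => t0; apply: H => _.
  rewrite (eserE _ (tent t * K t)) //.
  have -> : tent t = tent `|t|.
    by have [t1|t1] := ltP t 0; [rewrite ltr0_norm // tentN|rewrite ger0_norm].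
  have -> : series (fun m => h m t) = fun n =>
      series (fun m => 4 / (pi * m.*2.+1%:R) * expR (- (m.*2.+1%:R * pi * `|t|))) n * K t.
    by apply/funext => n; rewrite /series /= mulr_suml; apply: eq_bigr => m _;
      rewrite /h mulrA.
  by apply: cvgM; [apply: tent_series; rewrite normr_gt0|exact: cvg_cst].
rewrite E1 integral_nneseries //; last by move=> m t _; rewrite lee_fin.
rewrite -(eserE _ _ vl); apply: eq_eseriesr => m _.
rewrite EFinM -vE -ge0_integralZl ?lee_fin //.
- by apply/measurable_EFinP; exact: continuous_measurable_fun.
- by move=> t _; rewrite lee_fin mulr_ge0 ?expR_ge0.
Qed.

Let exp_fold m (K : R -> R) : continuous K -> (forall t, 0 <= K t) ->
  (\int[mu]_t (expR (- (rate m * `|t|)) * K t)%:E =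
   \int[mu]_(t in `[0%R, +oo[) (expR (- (rate m * t)) * (K t + K (- t)))%:E)%E.
Proof.
move=> cK K0; rewrite ge0_integralT_fold.
- apply: eq_integral => t; rewrite inE /= in_itv /= andbT => t0.
  by rewrite normrN ger0_norm // mulrDr.
- move=> t; apply: cvgM; last exact: cK.
  apply: continuous_comp; last exact: continuous_expR.
  apply: continuousN; apply: cvgM; first exact: cvg_cst.
  exact: norm_continuous.
- by move=> t; rewrite mulr_ge0 ?expR_ge0.
Qed.

Let coef_rate m w : coef m * (2 * rate m / (rate m ^+ 2 + w ^+ 2)) =
  8 / (m.*2.+1%:R ^+ 2 * pi ^+ 2 + w ^+ 2).
Proof.
rewrite /coef /rate.
have : 0 < m.*2.+1%:R :> R by rewrite ltr0n.
move: (m.*2.+1%:R : R) (pi : R) (pi_gt0 R) => d p p0 d0.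
have e0 : 0 < d ^+ 2 * p ^+ 2 + w ^+ 2.
  by rewrite ltr_wpDr ?sqr_ge0 // mulr_gt0 // exprn_gt0.
rewrite exprMn; move: (d ^+ 2 * p ^+ 2 + w ^+ 2) e0 => X X0.
by field; rewrite !gt_eqF.
Qed.

Let coef_rate0 m : coef m * (2 / rate m) = 8 / (m.*2.+1%:R ^+ 2 * pi ^+ 2 + 0 ^+ 2).
Proof.
rewrite -coef_rate; congr (_ * _); have := rate_gt0 m.
by move: (rate m) => r r0; rewrite expr0n addr0; field; rewrite gt_eqF.
Qed.

(** The summand 1 keeps the kernel nonnegative. Its own contribution is the same series at frequency
    0, so the total mass of the density comes out as [tanhc 0]. *)
Lemma integral_tent_cos w :
  (\int[mu]_t (tent t * (1 + cos (w * t)))%:E = (1 + tanhc w)%:E)%E.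
Proof.
have cos0 t : 0 <= 1 + cos (w * t) by have := cos_geN1 (w * t); lra.
have ccos : continuous (fun t : R => 1 + cos (w * t)).
  by apply: is_derive_continuous => t; apply: is_derive_eq.
apply: (@ge0_integral_tentM _
  (fun m => 2 / rate m + 2 * rate m / (rate m ^+ 2 + w ^+ 2))) => //.
- move=> m; rewrite exp_fold //.
  rewrite -integral_expR_cos ?rate_gt0 ?lexx ?ler0n //.
  by apply: eq_integral => t _; rewrite mulrN cosN; congr (_%:E); ring.
have tanhc0 : tanhc 0 = 1 :> R by rewrite /tanhc eqxx.
rewrite -[1 in X in (_ --> X)%classic]tanhc0.
have -> : series (fun m => coef m * (2 / rate m + 2 * rate m / (rate m ^+ 2 + w ^+ 2))) =
  series (fun m => 8 / (m.*2.+1%:R ^+ 2 * pi ^+ 2 + 0 ^+ 2)) +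
  series (fun m => 8 / (m.*2.+1%:R ^+ 2 * pi ^+ 2 + w ^+ 2)).
  apply/funext => n; rewrite fctE /series /= -big_split; apply: eq_bigr => m _ /=.
  by rewrite mulrDr coef_rate coef_rate0.
by apply: cvgD; exact: tanhc_series.
Qed.

(** Folding the line cancels the odd sine and leaves the constant 2, so only the frequency-0 series
    remains. At [w = 0] this is also the normalisation of [tent]. *)
Lemma integral_tent_sin w :
  (\int[mu]_t (tent t * (1 + sin (w * t)))%:E = 1%:E)%E.
Proof.
have sin0 t : 0 <= 1 + sin (w * t) by have := sin_geN1 (w * t); lra.
have csin : continuous (fun t : R => 1 + sin (w * t)).
  by apply: is_derive_continuous => t; apply: is_derive_eq.
apply: (@ge0_integral_tentM _ (fun m => 2 / rate m)) => //.
- move=> m; rewrite exp_fold //.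
  have -> : 2 / rate m = 2 / rate m + 0 * rate m / (rate m ^+ 2 + 0 ^+ 2).
    by rewrite !mul0r addr0.
  rewrite -integral_expR_cos ?rate_gt0 ?lexx ?ler0n //.
  by apply: eq_integral => t _; rewrite mulrN sinN; congr (_%:E); ring.
have tanhc0 : tanhc 0 = 1 :> R by rewrite /tanhc eqxx.
rewrite -[X in (_ --> X)%classic]tanhc0.
have -> : (fun m => coef m * (2 / rate m)) = fun m => 8 / (m.*2.+1%:R ^+ 2 * pi ^+ 2 + 0 ^+ 2).
  by apply/funext => m; exact: coef_rate0.
exact: tanhc_series.
Qed.

Lemma integral_tent : (\int[mu]_t (tent t)%:E = 1%:E)%E.
Proof.
rewrite -[RHS](integral_tent_sin 0); apply: eq_integral => t _.
by rewrite mul0r sin0 addr0 mulr1.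
Qed.

Lemma integrable_tent : mu.-integrable setT (EFin \o @tent R).
Proof.
apply/integrableP; split; first by apply/measurable_EFinP; exact: measurable_tent.
under eq_integral do rewrite /= ger0_norm ?tent_ge0 //.
by rewrite integral_tent ltry.
Qed.

Lemma integrable_tentM (K : R -> R) : continuous K -> (forall t, `|K t| <= 1) ->
  mu.-integrable setT (EFin \o (fun t => tent t * K t)).
Proof.
move=> cK K1; apply: (le_integrable _ _ _ integrable_tent) => //.
  apply/measurable_EFinP/measurable_funM; first exact: measurable_tent.
  exact: continuous_measurable_fun.
by move=> t _; rewrite /= lee_fin normrM ler_piMr.
Qed.

Lemma integrable_tent_cos w : mu.-integrable setT (EFin \o (fun t => tent t * cos (w * t))).
Proof.
apply: integrable_tentM => [|t]; last exact: cos_max.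
by apply: is_derive_continuous => t; apply: is_derive_eq.
Qed.

Lemma integrable_tent_sin w : mu.-integrable setT (EFin \o (fun t => tent t * sin (w * t))).
Proof.
apply: integrable_tentM => [|t]; last exact: sin_max.
by apply: is_derive_continuous => t; apply: is_derive_eq.
Qed.

Lemma Rintegral_tent : \int[mu]_t tent t = 1.
Proof.
by rewrite /Rintegral integral_tent.
Qed.

Lemma Rintegral_tent_cos w : \int[mu]_t (tent t * cos (w * t)) = tanhc w.
Proof.
have := integral_tent_cos w => /(congr1 fine) /=.
under eq_integral do rewrite mulrDr mulr1.
rewrite -/(Rintegral _ _ _) RintegralD //; [|exact: integrable_tent|exact: integrable_tent_cos].
by rewrite Rintegral_tent => /addrI.
Qed.

Lemma Rintegral_tent_sin w : \int[mu]_t (tent t * sin (w * t)) = 0.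
Proof.
have := integral_tent_sin w => /(congr1 fine) /=.
under eq_integral do rewrite mulrDr mulr1.
rewrite -/(Rintegral _ _ _) RintegralD //; [|exact: integrable_tent|exact: integrable_tent_sin].
by rewrite Rintegral_tent => /(canRL (addKr _)) ->; rewrite addNr.
Qed.

End TentIntegrals.

(** * Matrix exponential *)

Section ComplexLimits.
Variable R : realType.
Local Notation C := R[i].
Implicit Types (x y z : C) (u v : nat -> C).

Lemma ReD x y : complex.Re (x + y) = complex.Re x + complex.Re y.
Proof. by case: x y => [? ?] []. Qed.

Lemma ImD x y : complex.Im (x + y) = complex.Im x + complex.Im y.
Proof. by case: x y => [? ?] []. Qed.

Lemma ReM x y :
  complex.Re (x * y) = complex.Re x * complex.Re y - complex.Im x * complex.Im y.
Proof. by case: x y => [? ?] []. Qed.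

Lemma ImM x y :
  complex.Im (x * y) = complex.Re x * complex.Im y + complex.Im x * complex.Re y.
Proof. by case: x y => [? ?] []. Qed.

Lemma Re_sum (I : Type) (r : seq I) (P : pred I) (F : I -> C) :
  complex.Re (\sum_(i <- r | P i) F i) = \sum_(i <- r | P i) complex.Re (F i).
Proof. by elim/big_ind2 : _ => // ? ? ? ? <- <-; exact: ReD. Qed.

Lemma Im_sum (I : Type) (r : seq I) (P : pred I) (F : I -> C) :
  complex.Im (\sum_(i <- r | P i) F i) = \sum_(i <- r | P i) complex.Im (F i).
Proof. by elim/big_ind2 : _ => // ? ? ? ? <- <-; exact: ImD. Qed.

Lemma complex_eta z : complex.Re z +i* complex.Im z = z.
Proof. by case: z. Qed.

(** Componentwise, to match [expm], which takes the limits of real and imaginary parts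
    separately. *)
Definition cvgC u z :=
  ((fun n => complex.Re (u n)) @ \oo --> complex.Re z)%classic /\
  ((fun n => complex.Im (u n)) @ \oo --> complex.Im z)%classic.

Lemma cvgC_cst z : cvgC (fun=> z) z.
Proof. by split; exact: cvg_cst. Qed.

Lemma cvgCD u v x y : cvgC u x -> cvgC v y -> cvgC (fun n => u n + v n) (x + y).
Proof.
move=> [u1 u2] [v1 v2]; split.
  by under eq_fun do rewrite ReD; rewrite ReD; exact: cvgD.
by under eq_fun do rewrite ImD; rewrite ImD; exact: cvgD.
Qed.

Lemma cvgCM u v x y : cvgC u x -> cvgC v y -> cvgC (fun n => u n * v n) (x * y).
Proof.
move=> [u1 u2] [v1 v2]; split.
  by under eq_fun do rewrite ReM; rewrite ReM; apply: cvgB; exact: cvgM.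
by under eq_fun do rewrite ImM; rewrite ImM; apply: cvgD; exact: cvgM.
Qed.

Lemma cvgC_sum (I : Type) (r : seq I) (u : I -> nat -> C) (z : I -> C) :
  (forall i, cvgC (u i) (z i)) ->
  cvgC (fun n => \sum_(i <- r) u i n) (\sum_(i <- r) z i).
Proof.
move=> uz; elim: r => [|i r IH].
  rewrite big_nil (_ : (fun n => _) = fun=> 0); first exact: cvgC_cst.
  by apply/funext => n; rewrite big_nil.
rewrite big_cons (_ : (fun n => _) = fun n => u i n + \sum_(j <- r) u j n).
  exact: cvgCD.
by apply/funext => n; rewrite big_cons.
Qed.

Lemma cvgC_real (f : nat -> R) (l : R) :
  (f @ \oo --> l)%classic -> cvgC (fun n => (f n)%:C) l%:C.
Proof. by move=> fl; split => //=; exact: cvg_cst. Qed.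

Definition exp_psum (z : C) (N : nat) : C := \sum_(m < N) (m`!%:R)^-1 * z ^+ m.

Lemma exp_psum_real (r : R) : cvgC (exp_psum r%:C) (expR r)%:C.
Proof.
have -> : exp_psum r%:C = fun n => (series (exp_coeff r) n)%:C.
  apply/funext => n; rewrite /exp_psum /series /= big_mkord rmorph_sum /=.
  by apply: eq_bigr => m _; rewrite mulrC rmorphM rmorphXn fmorphV rmorph_nat.
apply: cvgC_real; exact: is_cvg_series_exp_coeff.
Qed.

(** Parity and halved exponent are written as in [cos_coeff] and [sin_coeff], so that the
    exponential series on the imaginary axis splits into these two term by term. *)
Lemma iX (m : nat) : ('i%C : C) ^+ m =
  ((~~ odd m)%:R * (-1) ^+ m./2) +i* ((odd m)%:R * (-1) ^+ m.-1./2).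
Proof.
elim: m => [|m IH]; first by rewrite expr0 /= mul1r mul0r expr0.
rewrite exprS IH; case: m {IH} => [|m]; apply/eqP;
  rewrite eq_complex /= !mul0r ?mul1r ?sub0r ?add0r ?negbK ?mulN1r
    ?exprS ?mulN1r ?mulrN ?oppr0 ?eqxx //.
Qed.

Lemma exp_psum_imag (t : R) : cvgC (exp_psum (0 +i* t)) (cos t +i* sin t).
Proof.
have E m : ((m`!%:R)^-1 : C) * (0 +i* t) ^+ m = cos_coeff t m +i* sin_coeff t m.
  have -> : (0 +i* t) = t%:C * 'i%C :> C.
    by simpc.
  rewrite exprMn iX -rmorphXn -(rmorph_nat (real_complex R)) -fmorphV.
  apply/eqP; rewrite eq_complex ?ReM ?ImM /= !mul0r ?subr0 ?addr0 /cos_coeff /sin_coeff /=.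
  by rewrite -!exprnP; apply/andP; split; apply/eqP; ring.
split.
  have -> : (fun n => complex.Re (exp_psum (0 +i* t) n)) = series (cos_coeff t).
    apply/funext => n; rewrite /exp_psum Re_sum /series /= big_mkord.
    by apply: eq_bigr => m _; rewrite E.
  by rewrite /= unlock; exact: is_cvg_series_cos_coeff.
have -> : (fun n => complex.Im (exp_psum (0 +i* t) n)) = series (sin_coeff t).
  apply/funext => n; rewrite /exp_psum Im_sum /series /= big_mkord.
  by apply: eq_bigr => m _; rewrite E.
by rewrite /= unlock; exact: is_cvg_series_sin_coeff.
Qed.

End ComplexLimits.

Section MatrixExponential.
Variables (R : realType) (n : nat).
Local Notation C := R[i].
Implicit Types (A B E U V : 'M[C]_n).

Definition expm_psum A (N : nat) : 'M[C]_n := \sum_(m < N) ((m`!)%:R : C)^-1 *: A ^+ m.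

Definition mx_cvg (S : nat -> 'M[C]_n) E := forall k l, cvgC (fun N => S N k l) (E k l).

(** The [limn] inside [expm] carries information only once convergence is known; explicit values of
    [expm] are obtained through this passage. *)
Lemma expm_cvg A E : mx_cvg (expm_psum A) E -> expm A = E.
Proof.
move=> AE; apply/matrixP => k l; rewrite mxE; have [cR cI] := AE k l.
by rewrite (cvg_lim _ cR) // (cvg_lim _ cI) // complex_eta.
Qed.

Lemma conj_diagE U V (d : 'I_n -> C) k l :
  (U *m diag_mx (\row_p d p) *m V) k l = \sum_p U k p * d p * V p l.
Proof.
by rewrite mxE; apply: eq_bigr => p _; rewrite mul_mx_diag !mxE.
Qed.

Lemma conj_diagX U V (d : 'I_n -> C) m : V *m U = 1%:M -> U *m V = 1%:M ->
  (U *m diag_mx (\row_p d p) *m V) ^+ m = U *m diag_mx (\row_p d p ^+ m) *m V.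
Proof.
move=> VU UV; elim: m => [|m IH].
  rewrite expr0 (_ : diag_mx _ = 1%:M) ?mulmx1 ?UV //.
  by apply/matrixP => i j; rewrite !mxE expr0.
rewrite exprS IH -[_ * _]/(_ *m _) !mulmxA -[_ *m V *m U]mulmxA VU mulmx1.
rewrite -[_ *m diag_mx _ *m diag_mx _]mulmxA mulmx_diag; congr (_ *m diag_mx _ *m _).
by apply/rowP => j; rewrite !mxE exprS.
Qed.

Lemma expm_psum_diag U V (d : 'I_n -> C) (e : 'I_n -> C) :
  V *m U = 1%:M -> U *m V = 1%:M ->
  (forall p, cvgC (exp_psum (d p)) (e p)) ->
  mx_cvg (expm_psum (U *m diag_mx (\row_p d p) *m V)) (U *m diag_mx (\row_p e p) *m V).
Proof.
move=> VU UV de k l; rewrite conj_diagE.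
rewrite (_ : (fun N => _) = fun N => \sum_p U k p * exp_psum (d p) N * V p l).
  apply: cvgC_sum => p; apply: cvgCM; last exact: cvgC_cst.
  by apply: cvgCM => //; exact: cvgC_cst.
apply/funext => N; rewrite /expm_psum summxE.
under eq_bigr => m _ do rewrite mxE conj_diagX // conj_diagE mulr_sumr.
rewrite exchange_big; apply: eq_bigr => p _ /=.
rewrite /exp_psum mulr_sumr mulr_suml; apply: eq_bigr => m _.
ring.
Qed.

End MatrixExponential.

(** * Derivative of the matrix exponential *)

Section QuadraticRemainder.
Variable R : realType.

(** Turns a second-order estimate into a derivative, so that limit and differentiation never have to
    be exchanged. *)
Lemma is_derive_quadratic (f : R -> R) (l M : R) :
  (forall s, `|s| <= 1 -> `|f s - f 0 - s * l| <= s ^+ 2 * M) ->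
  is_derive (0:R) (1:R) f l.
Proof.
move=> fM.
have cvg : ((fun h => h^-1 *: (f (h *: (1:R) + 0) - f 0)) @ 0^' --> l)%classic.
  apply/cvgrPdist_le => e e0; near=> h.
  have h0 : h != 0 by near: h; exact: nbhs_dnbhs_neq.
  (* The quotient is within [|h| * M] of [l]; dividing by [|M| + 1] covers every sign of [M] and the
     value 0. *)
  have h1 : `|h| <= Num.min 1 (e / (`|M| + 1)).
    near: h; apply: dnbhs0_le; rewrite lt_min ltr01 divr_gt0 //.
  move: h1; rewrite le_min => /andP[h1 h2].
  rewrite addr0 /GRing.scale /= mulr1.
  have -> : l - h^-1 * (f h - f 0) = - (h^-1 * (f h - f 0 - h * l)).
    by field.
  rewrite normrN normrM normfV ler_pdivrMl ?normr_gt0 //.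
  apply: le_trans (fM _ h1) _; rewrite -real_normK ?num_real // expr2 -mulrA.
  rewrite ler_wpM2l //; apply: le_trans (_ : `|h| * (`|M| + 1) <= e).
    by rewrite ler_wpM2l // (le_trans (ler_norm M)) // lerDl.
  by rewrite -ler_pdivlMr // ltr_wpDl.
apply: DeriveDef; first by apply/cvg_ex; exists l.
exact: cvg_lim.
Unshelve. all: by end_near. Qed.

End QuadraticRemainder.

(** * An entrywise norm and the second-order remainder of the exponential *)

Section MatrixNorm.
Variables (R : realType) (n : nat).
Local Notation C := R[i].
Implicit Types (A B E L : 'M[C]_n).

(** An l1 norm with values in [R], whereas the modulus on [R[i]] is itself complex-valued. It is
    submultiplicative and dominates both components. *)
Definition cnorm1 (z : C) : R := `|complex.Re z| + `|complex.Im z|.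

Lemma cnorm1_ge0 z : 0 <= cnorm1 z. Proof. by rewrite addr_ge0. Qed.

Lemma cnorm1D x y : cnorm1 (x + y) <= cnorm1 x + cnorm1 y.
Proof.
rewrite /cnorm1 ReD ImD addrACA; apply: lerD; exact: ler_normD.
Qed.

Lemma cnorm1M x y : cnorm1 (x * y) <= cnorm1 x * cnorm1 y.
Proof.
rewrite /cnorm1 ReM ImM mulrDl !mulrDr -!normrM.
have h1 := ler_normB (complex.Re x * complex.Re y) (complex.Im x * complex.Im y).
have h2 := ler_normD (complex.Re x * complex.Im y) (complex.Im x * complex.Re y).
lra.
Qed.

Lemma cnorm1_real (s : R) z : cnorm1 (s%:C * z) = `|s| * cnorm1 z.
Proof.
by rewrite /cnorm1 ReM ImM /= !mul0r subr0 addr0 !normrM mulrDr.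
Qed.

Lemma cnorm1_sum (I : Type) (r : seq I) (F : I -> C) :
  cnorm1 (\sum_(i <- r) F i) <= \sum_(i <- r) cnorm1 (F i).
Proof.
elim/big_ind2 : _ => //; first by rewrite /cnorm1 /= normr0 addr0.
by move=> x1 x2 y1 y2 h1 h2; apply: le_trans (cnorm1D _ _) (lerD h1 h2).
Qed.

Definition mxnorm1 A : R := \sum_k \sum_l cnorm1 (A k l).

Lemma mxnorm1_ge0 A : 0 <= mxnorm1 A.
Proof. by apply: sumr_ge0 => k _; apply: sumr_ge0 => l _; exact: cnorm1_ge0. Qed.

Lemma mxnorm1_entry A k l : cnorm1 (A k l) <= mxnorm1 A.
Proof.
rewrite /mxnorm1 (bigD1 k) //= (bigD1 l) //= -addrA lerDl.
by rewrite addr_ge0 ?sumr_ge0 // => *; rewrite ?sumr_ge0 // => *; exact: cnorm1_ge0.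
Qed.

Lemma mxnorm1D A B : mxnorm1 (A + B) <= mxnorm1 A + mxnorm1 B.
Proof.
rewrite /mxnorm1 -big_split; apply: ler_sum => k _ /=.
rewrite -big_split; apply: ler_sum => l _ /=; rewrite mxE; exact: cnorm1D.
Qed.

Lemma mxnorm1Z (s : R) A : mxnorm1 (s%:C *: A) = `|s| * mxnorm1 A.
Proof.
rewrite /mxnorm1 mulr_sumr; apply: eq_bigr => k _; rewrite mulr_sumr.
by apply: eq_bigr => l _; rewrite mxE cnorm1_real.
Qed.

Lemma mxnorm1M A B : mxnorm1 (A *m B) <= mxnorm1 A * mxnorm1 B.
Proof.
rewrite /mxnorm1 mulr_suml; apply: ler_sum => k _.
apply: (@le_trans _ _ (\sum_l \sum_p cnorm1 (A k p) * cnorm1 (B p l))).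
  apply: ler_sum => l _; rewrite mxE; apply: le_trans (cnorm1_sum _ _) _.
  by apply: ler_sum => p _; exact: cnorm1M.
rewrite exchange_big mulr_suml; apply: ler_sum => p _ /=.
rewrite -mulr_sumr ler_wpM2l ?cnorm1_ge0 //.
rewrite [leRHS](bigD1 p) //= lerDl.
by apply: sumr_ge0 => *; apply: sumr_ge0 => *; exact: cnorm1_ge0.
Qed.

(* Noncommutative derivative of [A ^+ m] in direction [B]:
   the sum of [A ^+ a *m B *m A ^+ b] over [a + b = m - 1]. *)
Fixpoint dpow A B (m : nat) : 'M[C]_n :=
  if m is m'.+1 then A *m dpow A B m' + B *m A ^+ m' else 0.

Definition dexpm_psum A B (N : nat) : 'M[C]_n :=
  \sum_(m < N) ((m`!)%:R : C)^-1 *: dpow A B m.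

Lemma subZ_entry (X Y Z : 'M[C]_n) (t : C) k l :
  (X - Y - t *: Z) k l = X k l - Y k l - t * Z k l.
Proof. by rewrite !mxE. Qed.

(** The additive bookkeeping of [pow_remainder], stated in a module because matrix products do not
    commute. There [e] stands for [B *m dpow A B m], inserted and removed to complete the product
    [(A + t B) *m dpow A B m]. *)
Lemma quadratic_term_cancel (V : lmodType C) (t : C) (q p d b e : V) :
  q - p - t *: (d + b) = q - (p + t *: b) - (t *: d + (t * t) *: e) + (t * t) *: e.
Proof. by rewrite scalerDr !opprD !addrA subrK addrAC. Qed.

Lemma expm_psumE A N k l : expm_psum A N k l = \sum_(m < N) (m`!%:R)^-1 * (A ^+ m) k l.
Proof. by rewrite /expm_psum summxE; apply: eq_bigr => m _; rewrite mxE. Qed.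

Lemma dexpm_psumE A B N k l :
  dexpm_psum A B N k l = \sum_(m < N) (m`!%:R)^-1 * dpow A B m k l.
Proof. by rewrite /dexpm_psum summxE; apply: eq_bigr => m _; rewrite mxE. Qed.

Section PowerRemainder.
Variables A B : 'M[C]_n.
Let c := mxnorm1 A + mxnorm1 B.
(** The identity need not have norm 1 in this norm; [K] accounts for the power 0. *)
Let K := mxnorm1 1.

Let c_ge0 : 0 <= c. Proof. by rewrite addr_ge0 ?mxnorm1_ge0. Qed.
Let K_ge0 : 0 <= K. Proof. exact: mxnorm1_ge0. Qed.

Let powA m : mxnorm1 (A ^+ m) <= K * mxnorm1 A ^+ m.
Proof.
elim: m => [|m IH]; first by rewrite !expr0 mulr1.
rewrite exprS; apply: le_trans (mxnorm1M _ _) _.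
by rewrite exprS mulrCA ler_wpM2l ?mxnorm1_ge0.
Qed.

Let powA_c m : mxnorm1 (A ^+ m) <= K * c ^+ m.
Proof.
apply: le_trans (powA m) _; rewrite ler_wpM2l // lerXn2r ?nnegrE ?mxnorm1_ge0 //.
by rewrite lerDl mxnorm1_ge0.
Qed.

Let dpow_c m : mxnorm1 (dpow A B m) <= K * c ^+ m.
Proof.
elim: m => [|m IH] /=.
  rewrite expr0 mulr1 [leLHS](_ : _ = 0) // /mxnorm1.
  by apply: big1 => k _; apply: big1 => l _; rewrite mxE /cnorm1 /= normr0 addr0.
apply: le_trans (mxnorm1D _ _) _.
apply: le_trans (lerD (mxnorm1M _ _) (mxnorm1M _ _)) _.
have -> : K * c ^+ m.+1 = mxnorm1 A * (K * c ^+ m) + mxnorm1 B * (K * c ^+ m).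
  by rewrite exprS mulrCA -mulrDl.
by apply: lerD; rewrite ler_wpM2l ?mxnorm1_ge0.
Qed.

Let rem (s : R) m := (A + s%:C *: B) ^+ m - A ^+ m - s%:C *: dpow A B m.

(** The remainder satisfies [rem (m+1) = (A + s B) rem m + s^2 B (dpow m)]. As [|s| <= 1], both
    [A + s B] and [B] have norm at most [c], so each step adds two contributions of size [c] times
    the previous bound: hence the base [2 * c]. *)
Lemma pow_remainder (s : R) m : `|s| <= 1 ->
  mxnorm1 (rem s m) <= s ^+ 2 * (K * (2 * c) ^+ m).
Proof.
move=> s1; elim: m => [|m IH].
  rewrite /rem /= !expr0 subrr sub0r scaler0 oppr0 [leLHS](_ : _ = 0).
    by rewrite mulr1 mulr_ge0 ?sqr_ge0.
  by apply: big1 => k _; apply: big1 => l _; rewrite mxE /cnorm1 /= normr0 addr0.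
have -> : rem s m.+1 = (A + s%:C *: B) *m rem s m + (s ^+ 2)%:C *: (B *m dpow A B m).
  have sE : (s ^+ 2)%:C = s%:C * s%:C :> C by rewrite -rmorphM expr2.
  rewrite /rem sE /= [(_ + _) ^+ m.+1]exprS [A ^+ m.+1]exprS.
  rewrite -[(A + _) * _]/((A + _) *m _) -[A * A ^+ m]/(A *m A ^+ m) !mulmxBr.
  move: ((A + _) *m (_ ^+ m)) => Q; rewrite !mulmxDl -!scalemxAl -!scalemxAr scalerA.
  exact: quadratic_term_cancel.
apply: le_trans (mxnorm1D _ _) _; rewrite mxnorm1Z ger0_norm ?sqr_ge0 //.
have h1 : mxnorm1 (A + s%:C *: B) <= c.
  apply: le_trans (mxnorm1D _ _) _; rewrite lerD2l mxnorm1Z ler_piMl //.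
  exact: mxnorm1_ge0.
have h2 : mxnorm1 ((A + s%:C *: B) *m rem s m) <= c * (s ^+ 2 * (K * (2 * c) ^+ m)).
  by apply: le_trans (mxnorm1M _ _) _; apply: ler_pM; rewrite ?mxnorm1_ge0.
have h3 : mxnorm1 (B *m dpow A B m) <= c * (K * (2 * c) ^+ m).
  apply: le_trans (mxnorm1M _ _) _; apply: ler_pM; rewrite ?mxnorm1_ge0 //.
    by rewrite lerDr mxnorm1_ge0.
  apply: le_trans (dpow_c m) _; rewrite ler_wpM2l // lerXn2r ?nnegrE ?mulr_ge0 //.
  by rewrite ler_peMl // ler1n.
have h4 : s ^+ 2 * mxnorm1 (B *m dpow A B m) <= s ^+ 2 * (c * (K * (2 * c) ^+ m)).
  by rewrite ler_wpM2l ?sqr_ge0.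
apply: le_trans (lerD h2 h4) _; rewrite [_ ^+ m.+1]exprS.
by rewrite le_eqVlt; apply/orP; left; apply/eqP; ring.
Qed.

(** The bounds of [pow_remainder] without [s ^+ 2], divided by factorials and summed; independent of
    [s] and of the truncation. *)
Let M := K * expR (2 * c).

Lemma expm_remainder (E E' L : 'M[C]_n) (s : R) k l : `|s| <= 1 ->
  mx_cvg (expm_psum A) E -> mx_cvg (expm_psum (A + s%:C *: B)) E' ->
  mx_cvg (dexpm_psum A B) L ->
  `|complex.Re (E' k l) - complex.Re (E k l) - s * complex.Re (L k l)| <= s ^+ 2 * M /\
  `|complex.Im (E' k l) - complex.Im (E k l) - s * complex.Im (L k l)| <= s ^+ 2 * M.
Proof.
move=> s1 cE cE' cL.
pose S N := expm_psum (A + s%:C *: B) N k l - expm_psum A N k l -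
  s%:C * dexpm_psum A B N k l.
have SB N : cnorm1 (S N) <= s ^+ 2 * M.
  have -> : S N = \sum_(m < N) ((m`!%:R)^-1 : R)%:C * rem s m k l.
    rewrite /S expm_psumE expm_psumE dexpm_psumE mulr_sumr -!sumrB.
    apply: eq_bigr => m _; rewrite fmorphV rmorph_nat mulrCA -!mulrBr.
    by rewrite /rem subZ_entry.
  apply: le_trans (cnorm1_sum _ _) _.
  apply: (@le_trans _ _ (\sum_(m < N) s ^+ 2 * K * (exp_coeff (2 * c) m))).
    apply: ler_sum => m _; rewrite cnorm1_real ger0_norm ?invr_ge0 //.
    rewrite mulrC /exp_coeff /= mulrA ler_wpM2r ?invr_ge0 //.
    apply: le_trans (mxnorm1_entry _ _ _) _; rewrite -mulrA; exact: pow_remainder.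
  rewrite -mulr_sumr /M mulrA (ler_wpM2l (mulr_ge0 (sqr_ge0 s) K_ge0)) //.
  rewrite -(big_mkord xpredT (exp_coeff (2 * c))) -/(series _ _).
  apply: nondecreasing_cvgn_le; last exact: is_cvg_series_exp_coeff.
  apply: nondecreasing_series => m _ _; exact: exp_coeff_ge0 (mulr_ge0 _ _).
have cS : cvgC S (E' k l - E k l - s%:C * L k l).
  have -> : S = fun N => expm_psum (A + s%:C *: B) N k l + (-1) * expm_psum A N k l +
     (- s%:C) * dexpm_psum A B N k l.
    by apply/funext => N; rewrite /S mulN1r mulNr.
  rewrite -(mulN1r (E k l)) -(mulNr s%:C).
  exact: (cvgCD (cvgCD (cE' k l) (cvgCM (cvgC_cst (-1)) (cE k l)))
    (cvgCM (cvgC_cst (- s%:C)) (cL k l))).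
have [cR cI] := cS.
have ReE (x y z : C) : complex.Re (x - y - s%:C * z) =
    complex.Re x - complex.Re y - s * complex.Re z.
  by case: x y z => [? ?] [? ?] [? ?] /=; rewrite !mul0r subr0.
have ImE (x y z : C) : complex.Im (x - y - s%:C * z) =
    complex.Im x - complex.Im y - s * complex.Im z.
  by case: x y z => [? ?] [? ?] [? ?] /=; rewrite !mul0r addr0.
rewrite -ReE -ImE; split.
  rewrite -(cvg_lim _ (cvg_norm cR)) //; apply: limr_le.
    by apply/cvg_ex; eexists; exact: cvg_norm cR.
  by apply: nearW => N; apply: le_trans (SB N); rewrite /cnorm1 lerDl.
rewrite -(cvg_lim _ (cvg_norm cI)) //; apply: limr_le.
  by apply/cvg_ex; eexists; exact: cvg_norm cI.
by apply: nearW => N; apply: le_trans (SB N); rewrite /cnorm1 lerDr.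
Qed.

End PowerRemainder.
End MatrixNorm.

(** * Unitary conjugation and the exponential of Hermitian matrices *)

Section Conjugation.
Variables (R : realType) (n : nat).
Local Notation C := R[i].
Implicit Types (A B U V W X : 'M[C]_n).

Lemma hermP A : (A \is hermsymmx) <-> A = A ^t*.
Proof.
split; first by move/is_hermitianmxP; rewrite expr0 scale1r.
by move=> AE; apply/is_hermitianmxP; rewrite expr0 scale1r.
Qed.

Lemma tmx_conjE A k l : (A ^t*) k l = conjc (A l k).
Proof. by rewrite !mxE. Qed.

Lemma tmx_conjM A B : (A *m B) ^t* = B ^t* *m A ^t*.
Proof. by rewrite trmx_mul map_mxM. Qed.

Lemma tmx_conjD A B : (A + B) ^t* = A ^t* + B ^t*.
Proof. by rewrite linearD /= map_mxD. Qed.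

Lemma tmx_conjZ (r : R) A : (r%:C *: A) ^t* = r%:C *: A ^t*.
Proof.
apply/matrixP => k l; rewrite tmx_conjE [in LHS]mxE [in RHS]mxE tmx_conjE.
by rewrite rmorphM /= oppr0.
Qed.

Lemma herm_opp A : A \is hermsymmx -> - A \is hermsymmx.
Proof.
move=> /hermP AE; apply/hermP/matrixP => k l.
by rewrite tmx_conjE mxE {1}AE tmx_conjE [in RHS]mxE rmorphN.
Qed.

Lemma herm_conj U A : A \is hermsymmx -> U ^t* *m A *m U \is hermsymmx.
Proof. by move=> /hermP AE; apply/hermP; rewrite !tmx_conjM trmxCK -AE mulmxA. Qed.

Lemma unitary_tmx U : U \is unitarymx -> U *m U ^t* = 1%:M /\ U ^t* *m U = 1%:M.
Proof. by move=> /unitarymxP UU; split => //; exact: mulmx1C. Qed.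

Lemma herm_spectral A : A \is hermsymmx ->
  exists V (d : 'I_n -> R), V \is unitarymx /\ A = V *m diag_mx (\row_p (d p)%:C) *m V ^t*.
Proof.
move=> hA; have /orthomx_spectralP AE := hermitian_normalmx hA.
have PU := spectral_unitarymx A.
exists ((spectralmx A) ^t*), (fun p => complex.Re (spectral_diag A 0 p)); split.
  by rewrite trmxC_unitary.
rewrite {1}AE invmx_unitary // trmxCK; congr (_ *m diag_mx _ *m _).
apply/rowP => p; rewrite mxE RRe_real //.
by have /mxOverP := hermitian_spectral_diag_real hA; apply.
Qed.

Lemma expm_psum_herm U (d : 'I_n -> R) : U \is unitarymx ->
  mx_cvg (expm_psum (U *m diag_mx (\row_p (d p)%:C) *m U ^t*))
         (U *m diag_mx (\row_p (expR (d p))%:C) *m U ^t*).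
Proof.
move=> /unitary_tmx [UU UU']; apply: expm_psum_diag => // p; exact: exp_psum_real.
Qed.

Lemma expm_imag U (d : 'I_n -> R) : U \is unitarymx ->
  expm (U *m diag_mx (\row_p (0 +i* d p)) *m U ^t*) =
  U *m diag_mx (\row_p (cos (d p) +i* sin (d p))) *m U ^t*.
Proof.
move=> /unitary_tmx [UU UU']; apply: expm_cvg.
by apply: expm_psum_diag => // p; exact: exp_psum_imag.
Qed.

(** Diagonalisation reduces convergence to the scalar exponential series of the eigenvalues. *)
Lemma expm_psum_cvg A : A \is hermsymmx -> mx_cvg (expm_psum A) (expm A).
Proof.
move=> /herm_spectral [V [d [VU ->]]].
by rewrite (expm_cvg (expm_psum_herm d VU)); exact: expm_psum_herm.
Qed.

Lemma trace_unitary_conj U A : U \is unitarymx -> \tr (U *m A *m U ^t*) = \tr A.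
Proof.
by move=> /unitary_tmx [_ UU]; rewrite mxtrace_mulC mulmxA UU mul1mx.
Qed.

Lemma trace_unitary_conjV U A : U \is unitarymx -> \tr (U ^t* *m A *m U) = \tr A.
Proof.
by move=> /unitary_tmx [UU _]; rewrite mxtrace_mulC mulmxA UU mul1mx.
Qed.

Lemma unitary_conjK U A : U \is unitarymx -> U *m (U ^t* *m A *m U) *m U ^t* = A.
Proof.
move=> /unitary_tmx [UU _].
by rewrite !mulmxA UU mul1mx -mulmxA UU mulmx1.
Qed.

Lemma unitary_conjKV U A : U \is unitarymx -> U ^t* *m (U *m A *m U ^t*) *m U = A.
Proof.
move=> /unitary_tmx [_ UU].
by rewrite !mulmxA UU mul1mx -mulmxA UU mulmx1.
Qed.

End Conjugation.

(** * Divided differences as matrix elements of the derivative *)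

Definition divdiff_exp (R : realType) (x y : R) : R :=
  if x == y then expR x else (expR x - expR y) / (x - y).

Section DividedDifference.
Variable R : realType.
Local Notation C := R[i].
Implicit Types x y : R.

(** The complete homogeneous polynomial of degree [m - 1] in two variables, that is, the divided
    difference of the m-th power. Its recursion copies that of [dpow]. *)
Fixpoint hpow x y (m : nat) : R := if m is m'.+1 then x * hpow x y m' + y ^+ m' else 0.

Lemma hpowE x y m : (x - y) * hpow x y m = x ^+ m - y ^+ m.
Proof.
elim: m => [|m IH] /=; first by rewrite mulr0 !expr0 subrr.
by rewrite mulrDr mulrCA IH !exprS; ring.
Qed.

Lemma hpow_diag x m : hpow x x m = m%:R * x ^+ m.-1.
Proof.
elim: m => [|m IH] /=; first by rewrite mul0r.
by rewrite IH; case: m {IH} => [|m] /=; rewrite ?exprS -?natr1; ring.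
Qed.

Lemma divdiff_exp_series x y :
  ((fun N => \sum_(m < N) (m`!%:R)^-1 * hpow x y m) @ \oo --> divdiff_exp x y)%classic.
Proof.
have cE z := @is_cvg_series_exp_coeff R z.
rewrite /divdiff_exp; have [<-|xy] := eqVneq x y.
  (* On the diagonal the term [m = 0] vanishes and [m / m! = 1 / (m - 1)!], so the sum is the
     exponential series one index later. *)
  rewrite -cvg_shiftS.
  rewrite (_ : (fun N => _) = series (exp_coeff x)); first exact: cE.
  apply/funext => N; rewrite big_ord_recl /= mulr0 add0r /series /= big_mkord.
  apply: eq_bigr => m _; rewrite [LHS](_ : _ = (m.+1)`!%:R^-1 * hpow x x m.+1) //
    hpow_diag succnK /exp_coeff /= factS natrM invfM.
  have : m.+1%:R != 0 :> R by rewrite pnatr_eq0.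
  by move: (m.+1%:R : R) (m`!%:R^-1 : R) => a b a0; field.
have xy0 : x - y != 0 by rewrite subr_eq0.
rewrite (_ : (fun N => _) =
    (fun N => (series (exp_coeff x) N - series (exp_coeff y) N) / (x - y))).
  by apply: cvgM; [apply: cvgB; exact: cE|exact: cvg_cst].
apply/funext => N; rewrite /series /= !big_mkord -sumrB mulr_suml; apply: eq_bigr => m _.
by rewrite /exp_coeff /= -mulrBl -hpowE; move: (m`!%:R^-1) => z; field.
Qed.

Variable n : nat.
Implicit Types (B U V D : 'M[C]_n).

Lemma dpow_conj U V D B m : V *m U = 1%:M -> U *m V = 1%:M ->
  dpow (U *m D *m V) (U *m B *m V) m = U *m dpow D B m *m V.
Proof.
move=> VU UV.
have pE p : (U *m D *m V) ^+ p = U *m D ^+ p *m V.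
  elim: p => [|p IH]; first by rewrite !expr0 mulmx1 UV.
  rewrite !exprS IH -[_ * (_ *m V)]/(_ *m (_ *m V)) -[D * _]/(D *m _).
  by rewrite !mulmxA -[_ *m V *m U]mulmxA VU mulmx1.
elim: m => [|m IH] /=; first by rewrite mulmx0 mul0mx.
rewrite IH pE mulmxDr mulmxDl !mulmxA -![_ *m V *m U]mulmxA VU !mulmx1.
by [].
Qed.

(** At a diagonal matrix the noncommutative derivative acts entrywise: factors left of [B]
    contribute [d k], those right of it [d l], which is the recursion of [hpow]. *)
Lemma dpow_diag (d : 'I_n -> R) B m k l :
  dpow (diag_mx (\row_p (d p)%:C)) B m k l = B k l * (hpow (d k) (d l) m)%:C.
Proof.
elim: m => [|m IH] /=; first by rewrite mxE mulr0.
have -> : diag_mx (\row_p (d p)%:C) ^+ m = diag_mx (\row_p ((d p) ^+ m)%:C).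
  elim: m {IH} => [|m IH]; first by apply/matrixP => i j; rewrite !mxE expr0.
  rewrite exprS IH -[_ * _]/(_ *m _) mulmx_diag; congr diag_mx.
  by apply/rowP => j; rewrite !mxE exprS rmorphM.
rewrite mxE mul_diag_mx mul_mx_diag !mxE IH rmorphD rmorphM /=.
by rewrite mulrDr mulrCA.
Qed.

(** The Daleckii-Krein formula for the derivative of the exponential in direction [B]: a Schur
    multiplier in the eigenbasis. *)
Definition dexpm U (d : 'I_n -> R) B : 'M[C]_n :=
  U *m (\matrix_(k, l) ((divdiff_exp (d k) (d l))%:C * (U ^t* *m B *m U) k l)) *m U ^t*.

Lemma dexpm_psum_cvg U (d : 'I_n -> R) B : U \is unitarymx ->
  mx_cvg (dexpm_psum (U *m diag_mx (\row_p (d p)%:C) *m U ^t*) B) (dexpm U d B).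
Proof.
move=> Uu; have [UU UU'] := unitary_tmx Uu => k l.
pose X := U ^t* *m B *m U.
pose S N := \sum_q (\sum_p U k p *
  ((\sum_(m < N) (m`!%:R)^-1 * hpow (d p) (d q) m)%:C * X p q)) * (U ^t*) q l.
have E N : dexpm_psum (U *m diag_mx (\row_p (d p)%:C) *m U ^t*) B N k l = S N.
  rewrite /S dexpm_psumE -{1}(unitary_conjK B Uu) -/X.
  under eq_bigr => m _ do rewrite dpow_conj // mxE mulr_sumr.
  rewrite exchange_big; apply: eq_bigr => q _ /=.
  under eq_bigr => m _ do rewrite mulrA.
  rewrite -mulr_suml; congr (_ * _).
  under [LHS]eq_bigr => m _ do rewrite mxE mulr_sumr.
  rewrite exchange_big; apply: eq_bigr => p _ /=.
  rewrite rmorph_sum mulr_suml mulr_sumr; apply: eq_bigr => m _.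
  rewrite dpow_diag rmorphM fmorphV rmorph_nat mulrCA; congr (_ * _).
  by rewrite -mulrA; congr (_ * _); exact: mulrC.
rewrite (_ : (fun N => _) = S).
  rewrite /dexpm mxE; apply: cvgC_sum => q; apply: cvgCM; last exact: cvgC_cst.
  rewrite mxE; apply: cvgC_sum => p; apply: cvgCM; first exact: cvgC_cst.
  rewrite mxE; apply: cvgCM; last exact: cvgC_cst.
  by apply: cvgC_real; exact: divdiff_exp_series.
by apply/funext => N; exact: E.
Qed.

Lemma is_derive_expm U (d : 'I_n -> R) B k l : U \is unitarymx -> B \is hermsymmx ->
  let A := U *m diag_mx (\row_p (d p)%:C) *m U ^t* in
  is_derive (0:R) (1:R) (fun s => complex.Re (expm (A + s%:C *: B) k l))
     (complex.Re (dexpm U d B k l)) /\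
  is_derive (0:R) (1:R) (fun s => complex.Im (expm (A + s%:C *: B) k l))
     (complex.Im (dexpm U d B k l)).
Proof.
move=> Uu hB A.
have hA : A \is hermsymmx.
  apply/hermP; rewrite /A !tmx_conjM trmxCK mulmxA; congr (_ *m _ *m _).
  by apply/matrixP => i j; rewrite tmx_conjE !mxE eq_sym; case: eqP => [->|_];
     rewrite ?mulr1n ?mulr0n /= ?oppr0 //; rewrite raddf0.
have hs (s : R) : (A + s%:C *: B) \is hermsymmx.
  by apply/hermP; rewrite tmx_conjD tmx_conjZ -(hermP A).1 // -(hermP B).1.
have A0 : A + (0:R)%:C *: B = A by rewrite scale0r addr0.
have rem s s1 := @expm_remainder R n A B _ _ _ s k l s1 (expm_psum_cvg hA)
  (expm_psum_cvg (hs s)) (dexpm_psum_cvg d B Uu).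
split; apply: is_derive_quadratic => s s1; rewrite A0.
  by have [h _] := rem s s1; exact: h.
by have [_ h] := rem s s1; exact: h.
Qed.

End DividedDifference.

(** * Gibbs states *)

Section IntegralSums.
Variable R : realType.
Local Notation mu := (@lebesgue_measure R).

Lemma Rintegral_sum (I : Type) (r : seq I) (F : I -> R -> R) (v : I -> R) :
  (forall i, mu.-integrable setT (EFin \o F i)) ->
  (forall i, \int[mu]_t F i t = v i) ->
  mu.-integrable setT (EFin \o (fun t => \sum_(i <- r) F i t)) /\
  \int[mu]_t (\sum_(i <- r) F i t) = \sum_(i <- r) v i.
Proof.
move=> iF vF; elim: r => [|i r [IH1 IH2]].
  split.
    rewrite (_ : _ \o _ = cst 0%E); first exact: integrable0.
    by apply/funext => t; rewrite /= big_nil.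
  under eq_Rintegral do rewrite big_nil.
  by rewrite big_nil Rintegral_cst // mul0r.
have E : (fun t => \sum_(j <- i :: r) F j t) = (fun t => F i t + \sum_(j <- r) F j t).
  by apply/funext => t; rewrite big_cons.
rewrite E big_cons; split; last by rewrite RintegralD // IH2 vF.
rewrite (_ : _ \o _ = ((EFin \o F i) \+ (EFin \o (fun t => (\sum_(j <- r) F j t)%R)))%E).
  exact: integrableD.
by apply/funext => t.
Qed.

Lemma integrable_tent_trig (w x y : R) :
  mu.-integrable setT (EFin \o (fun t => tent t * (x * cos (w * t) + y * sin (w * t)))).
Proof.
have i1 := integrableZl measurableT x (integrable_tent_cos w).
have i2 := integrableZl measurableT y (integrable_tent_sin w).
have := integrableD measurableT i1 i2; congr (integrable _ _ _).
by apply/funext => t /=; rewrite -!EFinM -EFinD; congr (_%:E); ring.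
Qed.

Lemma Rintegral_tent_trig (w x y : R) :
  \int[mu]_t (tent t * (x * cos (w * t) + y * sin (w * t))) = tanhc w * x.
Proof.
have i1 := integrable_tent_trig w x 0; have i2 := integrable_tent_trig w 0 y.
transitivity (\int[mu]_t (tent t * (x * cos (w * t) + 0 * sin (w * t)) +
                          tent t * (0 * cos (w * t) + y * sin (w * t)))).
  by apply: eq_Rintegral => t _; ring.
rewrite RintegralD //.
have -> : \int[mu]_t (tent t * (x * cos (w * t) + 0 * sin (w * t))) = tanhc w * x.
  transitivity (\int[mu]_t (tent t * cos (w * t)) * x); last by rewrite Rintegral_tent_cos.
  rewrite -RintegralZr //; last exact: integrable_tent_cos.
  by apply: eq_Rintegral => t _; ring.
have -> : \int[mu]_t (tent t * (0 * cos (w * t) + y * sin (w * t))) = 0.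
  transitivity (\int[mu]_t (tent t * sin (w * t)) * y); last by rewrite Rintegral_tent_sin mul0r.
  rewrite -RintegralZr //; last exact: integrable_tent_sin.
  by apply: eq_Rintegral => t _; ring.
by rewrite addr0.
Qed.

End IntegralSums.

Section Gibbs.
Variables (R : realType) (n J : nat) (G : 'I_J -> 'M[R[i]]_n).
Hypothesis hermG : forall j, G j \is hermsymmx.
Local Notation C := R[i].
Local Notation mu := (@lebesgue_measure R).
Implicit Types (th : 'rV[R]_J) (X : 'M[C]_n).

Lemma herm_Gth th : Gth G th \is hermsymmx.
Proof.
apply/hermP; rewrite /Gth; elim/big_rec : _ => [|j A _ AE].
  by apply/matrixP => k l; rewrite tmx_conjE !mxE conjc0.
by rewrite tmx_conjD tmx_conjZ -AE -(hermP (G j)).1.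
Qed.

Lemma Gth_shift th (s : R) i : Gth G (th + s *: delta_mx 0 i) = Gth G th + s%:C *: G i.
Proof.
rewrite /Gth.
under eq_bigr => j _ do rewrite !mxE /= rmorphD scalerDl.
rewrite big_split /=; congr (_ + _).
rewrite (bigD1 i) //= eqxx mulr1 big1 ?addr0 // => j /negbTE ji.
by rewrite ji mulr0 scale0r.
Qed.

(** A real partition function can be pulled out of the real and imaginary parts that [dpart]
    differentiates separately. *)
Lemma tr_expm_real (A : 'M[C]_n) : A \is hermsymmx ->
  (complex.Re (\tr (expm A)))%:C = \tr (expm A).
Proof.
move=> /herm_spectral [V [d [VU ->]]].
rewrite (expm_cvg (expm_psum_herm d VU)) trace_unitary_conj // mxtrace_diag.
have -> : \sum_i (\row_p (expR (d p))%:C : 'rV[C]_n) 0 i = (\sum_i expR (d i))%:C.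
  by rewrite rmorph_sum; apply: eq_bigr => i _; rewrite mxE.
by [].
Qed.

Section Eigenbasis.
Variables (th : 'rV[R]_J) (U : 'M[C]_n) (h : 'I_n -> R).
Hypothesis Uu : U \is unitarymx.
Hypothesis GE : Gth G th = U *m diag_mx (\row_p (h p)%:C) *m U ^t*.

Let Z := \sum_p expR (- h p).
Let w p := expR (- h p) / Z.
Let tilde X := U ^t* *m X *m U.

(** The index [k] witnesses a nonzero dimension; in dimension 0 the sum [Z] is empty. *)
Let Z_gt0 (k : 'I_n) : 0 < Z.
Proof.
by rewrite /Z (bigD1 k) //= ltr_wpDr ?expR_gt0 // sumr_ge0.
Qed.

Let NGE : - Gth G th = U *m diag_mx (\row_p (- h p)%:C) *m U ^t*.
Proof.
rewrite GE -mulNmx -mulmxN; congr (_ *m _ *m _).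
apply/matrixP => i j; rewrite !mxE rmorphN; case: (i == j); rewrite ?mulr1n ?mulr0n //.
exact: oppr0.
Qed.

Let expmE : expm (- Gth G th) = U *m diag_mx (\row_p (expR (- h p))%:C) *m U ^t*.
Proof. by rewrite NGE; exact: expm_cvg (expm_psum_herm _ Uu). Qed.

Let trE : \tr (expm (- Gth G th)) = Z%:C.
Proof.
rewrite expmE trace_unitary_conj // mxtrace_diag /Z rmorph_sum.
by apply: eq_bigr => i _; rewrite mxE.
Qed.

Lemma rho_eigen : rho G th = U *m diag_mx (\row_p (w p)%:C) *m U ^t*.
Proof.
rewrite /rho trE expmE -[Z%:C^-1]fmorphV scalemxAl scalemxAr; congr (_ *m _ *m _).
apply/matrixP => i j; rewrite !mxE; case: eqP => _; rewrite ?mulr1n ?mulr0n ?mulr0 //.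
by rewrite /w mulrC rmorphM.
Qed.

Lemma sum_w (k : 'I_n) : \sum_p w p = 1.
Proof. by rewrite -mulr_suml divff // gt_eqF // (Z_gt0 k). Qed.

Let m X := \sum_p (w p)%:C * tilde X p p.

Lemma trM_rho X : \tr (X *m rho G th) = m X.
Proof.
rewrite -{1}(unitary_conjK X Uu) rho_eigen -/(tilde X).
rewrite (_ : _ *m _ = U *m (tilde X *m diag_mx (\row_p (w p)%:C)) *m U ^t*); last first.
  have [_ UU] := unitary_tmx Uu.
  by rewrite !mulmxA -[_ *m U ^t* *m U]mulmxA UU mulmx1.
rewrite trace_unitary_conj // /mxtrace /m; apply: eq_bigr => p _.
by rewrite mul_mx_diag [LHS]mxE [X in _ * X]mxE mulrC.
Qed.

Let tilde_diag_real i p : (complex.Re (tilde (G i) p p))%:C = tilde (G i) p p.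
Proof.
have /hermP/esym/matrixP/(_ p p) := herm_conj U (hermG i); rewrite tmx_conjE
  -/(tilde (G i)).
by case: (tilde (G i) p p) => a b [] /eqP;
  rewrite eq_sym -addr_eq0 -mulr2n mulrn_eq0 /= => /eqP ->.
Qed.

Let phi k l := divdiff_exp (- h k) (- h l) / Z.

(** The product rule for [(z s)^-1] times the exponential: differentiating the exponential gives the
    divided-difference term, differentiating the normalisation gives the diagonal term with the mean
    of [G i]. *)
Lemma dpart_rho i k l :
  tilde (dpart (rho G) i th) k l =
  - ((phi k l)%:C * tilde (G i) k l) + (k == l)%:R * ((w k)%:C * m (G i)).
Proof.
have hNG : - G i \is hermsymmx by exact/herm_opp.
pose L := dexpm U (fun p => - h p) (- G i).
pose E s := expm (- Gth G th + s%:C *: - G i).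
have dE a b := @is_derive_expm R n U (fun p => - h p) (- G i) a b Uu hNG.
rewrite -NGE in dE.
have EE s : expm (- Gth G (th + s *: delta_mx 0 i)) = E s.
  by rewrite Gth_shift opprD /E scalerN.
have E0 : E 0 = expm (- Gth G th) by rewrite /E scale0r addr0.
pose z s := \sum_p complex.Re (E s p p).
pose dz := \sum_p complex.Re (L p p).
have z0 : z 0 = Z.
  by rewrite /z E0 -Re_sum -/(mxtrace _) trE.
have dzP : is_derive (0:R) (1:R) z dz.
  have -> : z = \sum_p (fun s => complex.Re (E s p p)).
    by apply/funext => s; rewrite fct_sumE.
  by apply: is_derive_sum => p; have [] := dE p p.
have Zk := Z_gt0 k.
have dV : is_derive (0:R) (1:R) (fun s => (z s)^-1) (- dz / Z ^+ 2).
  have zn0 : z 0 != 0 by rewrite z0 gt_eqF.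
  have := is_deriveV zn0 dzP; rewrite z0 => /is_derive_eq; apply.
  by rewrite /GRing.scale /=; field; rewrite gt_eqF.
have rhoE s a b : rho G (th + s *: delta_mx 0 i) a b = (z s)^-1%:C * E s a b.
  rewrite /rho EE mxE; congr (_ * _); rewrite fmorphV; congr (_^-1).
  have -> : z s = complex.Re (\tr (E s)) by rewrite /z -Re_sum.
  rewrite -EE; apply/esym/tr_expm_real.
  exact/herm_opp/herm_Gth.
have dpE : dpart (rho G) i th = Z^-1%:C *: L + (- dz / Z ^+ 2)%:C *: expm (- Gth G th).
  apply/matrixP => a b; rewrite [LHS]mxE [RHS]mxE [X in X + _]mxE [X in _ + X]mxE -E0.
  have [dR dI] := dE a b.
  rewrite -[RHS]complex_eta; congr (_ +i* _); rewrite derive1E.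
    rewrite (_ : (fun s => _) = (fun s => (z s)^-1 * complex.Re (E s a b))); last first.
      by apply/funext => s; rewrite rhoE ReM /= mul0r subr0.
    have [_ ->] : is_derive (0:R) (1:R) (fun s => (z s)^-1 * complex.Re (E s a b))
       ((z 0)^-1 * complex.Re (L a b) + complex.Re (E 0 a b) * (- dz / Z ^+ 2)).
      exact: is_derive_eq (is_deriveM dV dR) erefl.
    by rewrite z0 ReD !ReM /= !mul0r !subr0 [in LHS](mulrC (complex.Re (E 0 a b))).
  rewrite (_ : (fun s => _) = (fun s => (z s)^-1 * complex.Im (E s a b))); last first.
    by apply/funext => s; rewrite rhoE ImM /= mul0r addr0.
  have [_ ->] : is_derive (0:R) (1:R) (fun s => (z s)^-1 * complex.Im (E s a b))
     ((z 0)^-1 * complex.Im (L a b) + complex.Im (E 0 a b) * (- dz / Z ^+ 2)).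
    exact: is_derive_eq (is_deriveM dV dI) erefl.
  by rewrite z0 ImD !ImM /= !mul0r !addr0 [in LHS](mulrC (complex.Im (E 0 a b))).
have tN : tilde (- G i) = - tilde (G i) by rewrite /tilde mulmxN mulNmx.
have tL p q : tilde L p q = (divdiff_exp (- h p) (- h q))%:C * - tilde (G i) p q.
  have -> : tilde L = _ := unitary_conjKV _ Uu.
  rewrite mxE; congr (_ * _); rewrite -[LHS]/(tilde (- G i) p q) tN.
  by move: (tilde (G i)) => Y; rewrite mxE.
have Zw p : expR (- h p) = Z * w p.
  by rewrite /w; field; rewrite gt_eqF.
(* The trace meets only the diagonal multipliers [divdiff_exp (- h p) (- h p) = expR (- h p)], so
   the derivative of the partition function is minus [Z] times the mean of [G i]. *)
have dzE : dz%:C = - (Z%:C * m (G i)).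
  have -> : dz = complex.Re (\tr L) by rewrite /dz -Re_sum.
  rewrite -(trace_unitary_conjV L Uu) -[_ *m U]/(tilde L).
  pose q := \sum_p expR (- h p) * complex.Re (tilde (G i) p p).
  have -> : \tr (tilde L) = (- q)%:C.
    rewrite rmorphN rmorph_sum -sumrN; apply: eq_bigr => p _.
    by rewrite tL /divdiff_exp eqxx -{1}tilde_diag_real mulrN -rmorphM.
  rewrite -[complex.Re _]/(- q) rmorphN rmorph_sum /m mulr_sumr; congr (- _).
  apply: eq_bigr => p _; rewrite -[in RHS]tilde_diag_real Zw.
  move: (complex.Re _) (w p) Z => r v z'.
  by rewrite -mulrA !rmorphM.
have tE0 : tilde (expm (- Gth G th)) k l = (k == l)%:R * (expR (- h k))%:C.
  have -> : tilde (expm (- Gth G th)) = _ := congr1 tilde expmE.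
  have -> : tilde (U *m diag_mx (\row_p (expR (- h p))%:C) *m U ^t*) = _ := unitary_conjKV _ Uu.
  by rewrite [LHS]mxE [X in X *+ _]mxE mulr_natl.
have tildeD (X Y : 'M[C]_n) (x y : C) :
    tilde (x *: X + y *: Y) k l = x * tilde X k l + y * tilde Y k l.
  have -> : tilde (x *: X + y *: Y) = x *: tilde X + y *: tilde Y.
    by rewrite /tilde mulmxDr mulmxDl -!scalemxAr -!scalemxAl.
  by move: (tilde X) (tilde Y) => X' Y'; rewrite !mxE.
rewrite dpE tildeD tL tE0; congr (_ + _).
  rewrite -[phi k l]/(divdiff_exp (- h k) (- h l) * Z^-1).
  move: (tilde (G i) k l) (divdiff_exp _ _) (Z^-1) => y d v.
  by rewrite rmorphM; ring.
rewrite mulrCA; congr (_ * _).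
have -> : (w k)%:C = Z%:C * (Z ^- 2)%:C * (expR (- h k))%:C.
  rewrite (Zw k); move: (w k) (Z) Zk => v z' z'0.
  by rewrite -!rmorphM; congr (_%:C); field; rewrite gt_eqF.
have -> : (- dz / Z ^+ 2)%:C = - dz%:C * (Z ^- 2)%:C by rewrite rmorphM rmorphN.
rewrite dzE opprK; move: (m (G i)) (Z%:C) ((Z ^- 2)%:C) ((expR (- h k))%:C) => x1 x2 x3 x4.
by ring.
Qed.

(** Conjugation by the unitary evolution multiplies the [(p, q)] entry in the eigenbasis by the
    phase of frequency [h p - h q]; integrating this phase against the even density leaves its
    cosine transform. *)
Lemma Phi_eigen X k l : tilde (Phi G th X) k l = (tanhc (h k - h l))%:C * tilde X k l.
Proof.
suff -> : Phi G th X = U *m (\matrix_(p, q) ((tanhc (h p - h q))%:C * tilde X p q)) *m U ^t*.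
  by rewrite /tilde unitary_conjKV // mxE.
have diagZ (c : R) : (0 +i* c) *: Gth G th = U *m diag_mx (\row_p (0 +i* (c * h p))) *m U ^t*.
  rewrite GE scalemxAl scalemxAr; congr (_ *m _ *m _).
  apply/matrixP => p q; rewrite !mxE; case: eqP => _; rewrite ?mulr1n ?mulr0n ?mulr0 //.
  by apply/eqP; rewrite eq_complex ReM ImM /= !mulr0 !mul0r subr0 add0r !eqxx.
have UtE t : expm (- ((0 +i* t) *: Gth G th)) *m X *m expm ((0 +i* t) *: Gth G th) =
  U *m (\matrix_(p, q) ((cos ((h p - h q) * t) -i* sin ((h p - h q) * t)) * tilde X p q)) *m U ^t*.
  have -> : - ((0 +i* t) *: Gth G th) = (0 +i* (- t)) *: Gth G th.
    by rewrite -scaleNr; congr (_ *: _); apply/eqP; rewrite eq_complex /= oppr0 !eqxx.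
  have dE (a b : 'I_n -> C) :
      U *m diag_mx (\row_p a p) *m U ^t* *m X *m (U *m diag_mx (\row_p b p) *m U ^t*) =
      U *m (\matrix_(p, q) (a p * b q * tilde X p q)) *m U ^t*.
    transitivity (U *m (diag_mx (\row_p a p) *m (tilde X *m diag_mx (\row_p b p))) *m U ^t*).
      by rewrite /tilde !mulmxA.
    congr (_ *m _ *m _); move: (tilde X) => Y; apply/matrixP => p q.
    by rewrite mul_diag_mx mul_mx_diag !mxE; ring.
  rewrite !diagZ !expm_imag // dE; congr (_ *m _ *m _).
  apply/matrixP => p q; rewrite [LHS]mxE [RHS]mxE; congr (_ * _).
  apply/eqP; rewrite eq_complex ReM ImM /= mulNr cosN sinN !mulrBl cosB sinB ![_ * t]mulrC.
  by apply/andP; split; apply/eqP; ring.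
apply/matrixP => x y; rewrite mxE.
(* [Phi] integrates entries in the standard basis, so the [(x, y)] entry is expanded over pairs of
   eigenvectors; [a] holds its time-independent coefficients and [e] the phases. *)
pose a (pq : 'I_n * 'I_n) : C := U x pq.1 * tilde X pq.1 pq.2 * (U ^t*) pq.2 y.
have entryE (M : 'M[C]_n) (c : 'I_n * 'I_n -> C) :
    M = \matrix_(p, q) (c (p, q) * tilde X p q) ->
    (U *m M *m U ^t*) x y = \sum_pq c pq * a pq.
  move=> ->; rewrite mxE; under eq_bigr => q _ do rewrite mxE mulr_suml.
  rewrite exchange_big pair_big; apply: eq_bigr => -[p q] _ /=.
  by rewrite mxE /a /= mulrCA !mulrA.
pose e t (pq : 'I_n * 'I_n) : C :=
  cos ((h pq.1 - h pq.2) * t) -i* sin ((h pq.1 - h pq.2) * t).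
rewrite (entryE _ (fun pq => (tanhc (h pq.1 - h pq.2))%:C) erefl).
under eq_Rintegral => t _ do
  rewrite UtE (entryE _ (e t) erefl) Re_sum mulr_sumr.
under [X in _ +i* X]eq_Rintegral => t _ do
  rewrite UtE (entryE _ (e t) erefl) Im_sum mulr_sumr.
rewrite -[RHS]complex_eta Re_sum Im_sum; congr (_ +i* _).
  pose F pq t := tent t * complex.Re (e t pq * a pq).
  have FE pq : F pq = fun t => tent t * (complex.Re (a pq) * cos ((h pq.1 - h pq.2) * t) +
                           complex.Im (a pq) * sin ((h pq.1 - h pq.2) * t)).
    by apply/funext => t; rewrite /F ReM /=; congr (_ * _); ring.
  have [||_ ->] := @Rintegral_sum R _ (index_enum _) F
    (fun pq => tanhc (h pq.1 - h pq.2) * complex.Re (a pq)).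
  - by move=> pq; rewrite FE; exact: integrable_tent_trig.
  - by move=> pq; rewrite FE; exact: Rintegral_tent_trig.
  - by apply: eq_bigr => pq _; rewrite [RHS]ReM mul0r subr0.
pose F pq t := tent t * complex.Im (e t pq * a pq).
have FE pq : F pq = fun t => tent t * (complex.Im (a pq) * cos ((h pq.1 - h pq.2) * t) +
                         (- complex.Re (a pq)) * sin ((h pq.1 - h pq.2) * t)).
  by apply/funext => t; rewrite /F ImM /=; congr (_ * _); ring.
have [||_ ->] := @Rintegral_sum R _ (index_enum _) F
    (fun pq => tanhc (h pq.1 - h pq.2) * complex.Im (a pq)).
- by move=> pq; rewrite FE; exact: integrable_tent_trig.
- by move=> pq; rewrite FE; exact: Rintegral_tent_trig.
- by apply: eq_bigr => pq _; rewrite [RHS]ImM mul0r addr0.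
Qed.

End Eigenbasis.
End Gibbs.

(** * Kubo-Mori weights and the final summation *)

Section KuboMoriWeights.
Variable R : realType.
Implicit Types x y Z : R.

Lemma divdiff_exp_sym x y : divdiff_exp x y = divdiff_exp y x.
Proof.
rewrite /divdiff_exp eq_sym; case: eqP => [->//|_].
by rewrite -[x - y]opprB -[expR x - _]opprB invrN mulrNN.
Qed.

(** With [a = expR (- x)] and [b = expR (- y)], the ratio [(a - b) / (a + b)] is tanh ((y - x) / 2).
    The remaining average of [a] and [b] produces the anticommutator. *)
Lemma divdiff_exp_tanhc x y :
  divdiff_exp (- x) (- y) = tanhc (y - x) * ((expR (- x) + expR (- y)) / 2).
Proof.
rewrite /divdiff_exp /tanhc eqr_opp subr_eq0 eq_sym; case: eqP => [->|/eqP yx].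
  by field.
have -> : expR (y - x) = expR (- x) / expR (- y) by rewrite addrC expRD !expRN invrK.
have [a0 b0] := (expR_gt0 (- x), expR_gt0 (- y)).
have yx0 : y - x != 0 by rewrite subr_eq0.
move: (expR (- x)) (expR (- y)) a0 b0 => a b a0 b0.
have ab : 0 < a + b by rewrite addr_gt0.
rewrite (_ : - x - - y = y - x); last by ring.
by field; rewrite yx0 !gt_eqF.
Qed.

(** The logarithms undo the exponentials and [ln Z] cancels in their difference, which leaves the
    reciprocal of the divided difference. *)
Lemma cKM_gibbs x y Z : 0 < Z ->
  cKM (expR (- x) / Z) (expR (- y) / Z) * (divdiff_exp (- x) (- y) / Z) = 1.
Proof.
move=> Z0; have Zn0 : Z != 0 by rewrite gt_eqF.
have [a0 b0] := (expR_gt0 (- x), expR_gt0 (- y)).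
rewrite /cKM /divdiff_exp !ln_div ?posrE // !expRK.
have -> : (expR (- x) / Z == expR (- y) / Z) = (- x == - y).
  by rewrite (inj_eq (mulIf _)) ?invr_eq0 // (inj_eq (@expR_inj R)).
case: eqP => [->|/eqP xy]; first by rewrite mulVf // mulf_neq0 ?invr_eq0 // gt_eqF.
have eab : expR (- x) - expR (- y) != 0 by rewrite subr_eq0 (inj_eq (@expR_inj R)).
have xy0 : - x - - y != 0 by rewrite subr_eq0.
move: (expR (- x)) (expR (- y)) (- x) (- y) eab xy0 => a b u v ab uv.
by field; rewrite ab uv Zn0.
Qed.

End KuboMoriWeights.

Lemma unitary_intertwine (R : realType) (n : nat) (U V A B : 'M[R[i]]_n) :
  U \is unitarymx -> V \is unitarymx -> U *m A *m U ^t* = V *m B *m V ^t* ->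
  B *m (V ^t* *m U) = V ^t* *m U *m A.
Proof.
move=> /unitary_tmx [_ UU] /unitary_tmx [_ VV] /(congr1 (fun M => V ^t* *m M *m U)).
by rewrite !mulmxA VV mul1mx -[_ *m U ^t* *m U]mulmxA UU mulmx1.
Qed.

Lemma diag_mulmxE (F : comNzRingType) (n : nat) (d : 'I_n -> F) (A : 'M[F]_n) k l :
  (diag_mx (\row_p d p) *m A) k l = d k * A k l.
Proof. by rewrite mul_diag_mx !mxE. Qed.

Lemma mulmx_diagE (F : comNzRingType) (n : nat) (d : 'I_n -> F) (A : 'M[F]_n) k l :
  (A *m diag_mx (\row_p d p)) k l = A k l * d l.
Proof. by rewrite mul_mx_diag !mxE. Qed.

(* [rho] determines [G(th)] up to the additive constant [ln Z], so any
   eigenbasis of [rho] is one of [G(th)]. *)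
Lemma Gth_eigen_of_rho (R : realType) (n J : nat) (G : 'I_J -> 'M[R[i]]_n)
    (hermG : forall j, G j \is hermsymmx) (th : 'rV[R]_J) (U : 'M[R[i]]_n) (lam : 'I_n -> R) :
  spectral_decomp (rho G th) U lam ->
  exists2 h : 'I_n -> R, Gth G th = U *m diag_mx (\row_p (h p)%:C) *m U ^t* &
    forall p, lam p = expR (- h p) / \sum_q expR (- h q).
Proof.
move=> [Uu rhoE].
have [V [g [Vu GE]]] := herm_spectral (herm_Gth hermG th).
pose Z := \sum_q expR (- g q); pose W := V ^t* *m U.
have [UU UU'] := unitary_tmx Uu; have [VV VV'] := unitary_tmx Vu.
have Z0 (k : 'I_n) : 0 < Z.
  by rewrite /Z (bigD1 k) //= ltr_wpDr ?expR_gt0 // sumr_ge0.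
have WE : diag_mx (\row_p (expR (- g p) / Z)%:C) *m W = W *m diag_mx (\row_p (lam p)%:C).
  exact: unitary_intertwine Uu Vu (etrans (esym rhoE) (rho_eigen Vu GE)).
(* Solves [lam p = expR (- h p) / Z] with the partition function [Z] of the auxiliary eigenbasis
   [V]. *)
pose h p := - ln (Z * lam p).
(* [W] intertwines the two diagonal forms, so a nonzero entry links equal eigenvalues. Degenerate
   eigenspaces, on which [W] is an arbitrary unitary block, are thereby covered. *)
have We p q : W p q != 0 -> lam q = expR (- g p) / Z.
  move=> W0; have /matrixP /(_ p q) := WE.
  rewrite diag_mulmxE mulmx_diagE mulrC => E.
  exact/esym/complexI/(mulfI W0 E).
have hE p q : W p q != 0 -> h q = g p.
  move=> W0; rewrite /h (We _ _ W0) mulrC divfK ?gt_eqF ?(Z0 p) //.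
  by rewrite expRK opprK.
have GU : Gth G th = U *m diag_mx (\row_p (h p)%:C) *m U ^t*.
  have WD : diag_mx (\row_p (g p)%:C) *m W = W *m diag_mx (\row_p (h p)%:C).
    apply/matrixP => p q; rewrite diag_mulmxE mulmx_diagE.
    by have [->|/hE ->] := eqVneq (W p q) 0; [rewrite mulr0 mul0r|rewrite mulrC].
  have VE : V ^t* = W *m U ^t* by rewrite /W -mulmxA UU mulmx1.
  rewrite GE VE mulmxA -[V *m _ *m W]mulmxA WD /W !mulmxA VV mul1mx.
  by [].
exists h => // p.
(* Comparing the diagonals of two forms of [rho] in the basis [U] expresses [lam] with the
   normalisation built from [h] itself. *)
have := rho_eigen Uu GU; rewrite rhoE => /(congr1 (fun M => U ^t* *m M *m U)).
rewrite !unitary_conjKV // => /matrixP /(_ p p); rewrite !mxE eqxx !mulr1n.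
by move/complexI.
Qed.

Lemma unitary_conjM (R : realType) (n : nat) (U A B : 'M[R[i]]_n) : U \is unitarymx ->
  U ^t* *m (A *m B) *m U = (U ^t* *m A *m U) *m (U ^t* *m B *m U).
Proof.
move=> /unitary_tmx [UU _].
by rewrite !mulmxA -[_ *m U *m U ^t*]mulmxA UU mulmx1.
Qed.

(** The algebra of the argument, free of analysis. Off the diagonal, [c * w = 1] cancels one of the
    two factors [w]; the diagonal gives the product of means. Normalisation is assumed only after
    multiplication by [mi * mj], which remains true in dimension 0. *)
Lemma KM_sum (F : fieldType) (n : nat) (c w : 'I_n -> 'I_n -> F) (lam : 'I_n -> F)
    (X Y P DX DY : 'M[F]_n) :
  let mi := \sum_p lam p * X p p in
  let mj := \sum_p lam p * Y p p in
  (forall k, w k k = lam k) -> (forall k l, w k l = w l k) ->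
  (forall k l, c k l * w k l = 1) ->
  (forall k l, w k l * Y l k = 2^-1 * (lam k + lam l) * P l k) ->
  mi * mj * (\sum_p lam p) = mi * mj ->
  (forall k l, DX k l = - (w k l * X k l) + (k == l)%:R * (lam k * mi)) ->
  (forall k l, DY k l = - (w k l * Y k l) + (k == l)%:R * (lam k * mj)) ->
  \sum_k \sum_l c k l * DX k l * DY l k =
  2^-1 * (\sum_p lam p * (X *m P + P *m X) p p) - mi * mj.
Proof.
move=> mi mj wkk wsym cw wP lam1 DXE DYE.
(* On the diagonal the summand is [lam k * (X k k - mi) * (Y k k - mj)]; the conditional collects
   what this adds to [lam k * X k k * Y k k]. *)
have term k l : c k l * DX k l * DY l k = w k l * X k l * Y l k + (if l == k then
    mi * mj * lam k - mj * (lam k * X k k) - mi * (lam k * Y k k) else 0).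
  rewrite DXE DYE (wsym l k) (eq_sym k l); have := cw k l; case: eqP => [->|_] cw1.
    rewrite wkk in cw1 *.
    rewrite !mul1r (_ : c k k * _ * _ =
      (c k k * lam k) * (lam k * (mi - X k k) * (mj - Y k k))); last by ring.
    by rewrite cw1; ring.
  rewrite !mul0r !addr0 [LHS](_ : _ = (c k l * w k l) * X k l * (w k l * Y l k)); last by ring.
  by rewrite cw1; ring.
under eq_bigr => k _ do under eq_bigr => l _ do rewrite term.
under eq_bigr => k _ do rewrite big_split /= -big_mkcond big_pred1_eq.
rewrite big_split /= !sumrB -!mulr_sumr -/mi -/mj lam1.
have -> : mi * mj - mj * mi - mi * mj = - (mi * mj) by ring.
congr (_ + _).
(* The weights [lam k] and [lam l] yield the two orderings of the anticommutator, after renaming the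
   indices in one of the sums. *)
transitivity (2^-1 * \sum_k \sum_l (lam k + lam l) * (X k l * P l k)).
  rewrite mulr_sumr; apply: eq_bigr => k _; rewrite mulr_sumr; apply: eq_bigr => l _.
  by rewrite mulrAC wP; ring.
congr (_ * _).
transitivity (\sum_p \sum_l (lam p * (X p l * P l p) + lam p * (P p l * X l p))).
  under [RHS]eq_bigr => p _ do rewrite big_split.
  under [LHS]eq_bigr => p _ do under eq_bigr => l _ do rewrite mulrDl.
  under [LHS]eq_bigr => p _ do rewrite big_split.
  rewrite !big_split /=; congr (_ + _); rewrite exchange_big.
  by apply: eq_bigr => p _; apply: eq_bigr => l _; congr (_ * _); exact: mulrC.
apply: eq_bigr => p _; rewrite [in RHS]mxE [X in _ * (X + _)]mxE [X in _ * (_ + X)]mxE.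
by rewrite -big_split mulr_sumr; apply: eq_bigr => l _ /=; rewrite mulrDr.
Qed.

Unset Implicit Arguments.

Theorem theorem2 (R : realType) (n J : nat) (G : 'I_J -> 'M[R[i]]_n)
  (hermG : forall j, G j \is hermsymmx)
  (th : 'rV[R]_J) (U : 'M[R[i]]_n) (lam : 'I_n -> R)
  (hdec : spectral_decomp (rho G th) U lam) (i j : 'I_J) :
  KM_info (rho G) th U lam i j =
  2^-1 * \tr ((G i *m Phi G th (G j) + Phi G th (G j) *m G i) *m rho G th)
  - \tr (G i *m rho G th) * \tr (G j *m rho G th).
Proof.
have [h GE /funext lamE] := Gth_eigen_of_rho hermG hdec.
have [Uu _] := hdec; subst lam.
set Z := \sum_q expR (- h q).
set lam := fun p => expR (- h p) / Z.
have Z0 (k : 'I_n) : 0 < Z by rewrite /Z (bigD1 k) //= ltr_wpDr ?expR_gt0 // sumr_ge0.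
pose X := U ^t* *m G i *m U; pose Y := U ^t* *m G j *m U.
pose P := U ^t* *m Phi G th (G j) *m U.
pose w k l : R := divdiff_exp (- h k) (- h l) / Z.
pose mi := \sum_p (lam p)%:C * X p p; pose mj := \sum_p (lam p)%:C * Y p p.
have wkk k : w k k = lam k by rewrite /w /divdiff_exp eqxx.
have wsym k l : w k l = w l k by rewrite /w divdiff_exp_sym.
have cw k l : (cKM (lam k) (lam l))%:C * (w k l)%:C = 1.
  by rewrite -rmorphM /w cKM_gibbs ?(Z0 k).
(* The transposed entry [(l, k)] has frequency [h l - h k], which is the argument of [tanhc] in
   [divdiff_exp_tanhc]. *)
have wP k l : (w k l)%:C * Y l k = 2^-1 * ((lam k)%:C + (lam l)%:C) * P l k.
  have -> : P l k = (tanhc (h l - h k))%:C * Y l k := Phi_eigen Uu GE _ _ _.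
  rewrite mulrA; congr (_ * _).
  have -> : w k l = 2^-1 * (lam k + lam l) * tanhc (h l - h k).
    by rewrite /w divdiff_exp_tanhc /lam -mulrDl;
       move: (tanhc _) (Z^-1) (expR _ + expR _) => u v e; field.
  by rewrite rmorphM rmorphM rmorphD fmorphV rmorph_nat.
have DX k l : (U ^t* *m dpart (rho G) i th *m U) k l =
    - ((w k l)%:C * X k l) + (k == l)%:R * ((lam k)%:C * mi) := dpart_rho hermG Uu GE i k l.
have DY k l : (U ^t* *m dpart (rho G) j th *m U) k l =
    - ((w k l)%:C * Y k l) + (k == l)%:R * ((lam k)%:C * mj) := dpart_rho hermG Uu GE j k l.
have lam1 : mi * mj * (\sum_p (lam p)%:C) = mi * mj.
  (* In dimension 0 the weights do not sum to 1, but [mi] is an empty sum and both sides vanish. *)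
  case: (pickP (fun _ : 'I_n => true)) => [k _|no].
    have -> : \sum_p (lam p)%:C = 1 :> R[i].
      by rewrite -rmorph_sum -[RHS](rmorph1 (real_complex R)) -(sum_w h k).
    by rewrite mulr1.
  by rewrite [mi]big1 ?mul0r // => p; have := no p.
have trE (A : 'M[R[i]]_n) : \tr (A *m rho G th) = \sum_p (lam p)%:C * (U ^t* *m A *m U) p p.
  exact: trM_rho Uu GE A.
rewrite !trE mulmxDr mulmxDl -/X -/Y.
have -> : U ^t* *m (G i *m Phi G th (G j)) *m U = X *m P by exact: unitary_conjM.
have -> : U ^t* *m (Phi G th (G j) *m G i) *m U = P *m X by exact: unitary_conjM.
have K := KM_sum (fun k => congr1 (real_complex R) (wkk k))
  (fun k l => congr1 (real_complex R) (wsym k l)) cw wP lam1 DX DY.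
exact: K.
Qed.
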